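(* Assume that $\mathcal{C}$ is Hom-finite and locally bounded. If $(\mathsf{X},\mathsf{W})$ is a left Frobenius pair in ${}_{A}\mathsf{Mod}$, then $(\mathrm{Fun}(\mathcal{C},\mathsf{X}),\widetilde{\mathsf{W}})$ is a left Frobenius pair in ${}_{\mathcal{C},A}\mathsf{Mod}$.
   Context: Let $\Bbbk$ be a commutative ring, $A$ an associative $\Bbbk$-algebra, and $\mathcal{C}$ a small $\Bbbk$-linear category such that $\mathcal{C}(p,q)$ is a projective $\Bbbk$-module for all $p,q\in\mathcal{C}$. ${}_{A}\mathsf{Mod}$ is the category of left $A$-modules and ${}_{\mathcal{C},A}\mathsf{Mod}$ is the category of $\Bbbk$-linear functors $\mathcal{C}\to{}_{A}\mathsf{Mod}$. ''Subcategory'' means full additive subcategory closed under isomorphisms and finite coproducts. Hom-finite: each $\mathcal{C}(p,q)$ is a finitely generated projective $\Bbbk$-module. Locally bounded: for every $q\in\mathcal{C}$ there are only finitely many objects of $\mathcal{C}$ mapping nontrivially into or out of $q$. For $q\in\mathcal{C}$ let $G_q:{}_{A}\mathsf{Mod}\to{}_{\mathcal{C},A}\mathsf{Mod}$, $G_q(M)=\mathrm{Hom}_{\Bbbk}(\mathcal{C}(-,q),M)$ (right adjoint of evaluation at $q$). For a subcategory $\mathsf{X}$ of ${}_{A}\mathsf{Mod}$: $\mathrm{Fun}(\mathcal{C},\mathsf{X})=\{X\in{}_{\mathcal{C},A}\mathsf{Mod}\mid X(q)\in\mathsf{X}\text{ for each }q\in\mathcal{C}\}$, and $\widetilde{\mathsf{X}}=\mathrm{Add}\{G_q(N_q)\mid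 q\in\mathcal{C},N_q\in\mathsf{X}\}$, i.e. the class of direct summands of objects $\bigoplus_{q\in\mathcal{C}}G_q(N_q)$ for families $(N_q)_{q\in\mathcal{C}}$ of objects of $\mathsf{X}$. In an abelian category $\mathsf{A}$, a subcategory $\mathsf{W}$ is an injective cogenerator for a subcategory $\mathsf{X}$ if $\mathsf{W}\subseteq\mathsf{X}$, for each $X\in\mathsf{X}$ there is a short exact sequence $0\to X\to W\to X'\to0$ with $W\in\mathsf{W}$, $X'\in\mathsf{X}$, and $\mathrm{Ext}^i_{\mathsf{A}}(X,W)=0$ for all $X\in\mathsf{X}$, $W\in\mathsf{W}$, $i\geqslant1$. A pair $(\mathsf{X},\mathsf{W})$ of subcategories of $\mathsf{A}$ is a left Frobenius pair if $\mathsf{X}$ is closed under extensions, kernels of epimorphisms and direct summands in $\mathsf{A}$, and $\mathsf{W}$ is an injective cogenerator for $\mathsf{X}$ closed under direct summands in $\mathsf{A}$. *)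

(* Defs.v *)
From HB Require Import structures.
From mathcomp Require Import all_boot all_algebra.
From mathcomp Require Import boolp classical_sets functions cardinality.
Set Implicit Arguments.
Unset Strict Implicit.
Unset Printing Implicit Defensive.
Import GRing.Theory.
Local Open Scope ring_scope.
Local Obligation Tactic := idtac.

Record preadditive := Preadditive {
  obj :> Type;
  mor : obj -> obj -> zmodType;
  idm : forall X, mor X X;
  compm : forall X Y Z, mor Y Z -> mor X Y -> mor X Z;
  comp1m : forall X Y (f : mor X Y), compm (idm Y) f = f;
  compm1 : forall X Y (f : mor X Y), compm f (idm X) = f;
  compmA : forall X Y Z T (h : mor Z T) (g : mor Y Z) (f : mor X Y),
    compm h (compm g f) = compm (compm h g) f;
  compDl : forall X Y Z (g g' : mor Y Z) (f : mor X Y),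
    compm (g + g') f = compm g f + compm g' f;
  compDr : forall X Y Z (g : mor Y Z) (f f' : mor X Y),
    compm g (f + f') = compm g f + compm g f' }.

Arguments idm {p} X.
Local Notation "g ∘ f" := (compm g f) (at level 40, left associativity).

Section Preadditive.
Variable A : preadditive.
Implicit Types X Y Z K W S : A.

Definition isomorphic X Y :=
  exists (f : mor X Y) (g : mor Y X), g ∘ f = idm X /\ f ∘ g = idm Y.

Definition epi X Y (f : mor X Y) :=
  forall Z (g h : mor Y Z), g ∘ f = h ∘ f -> g = h.

Definition is_kernel K X Y (i : mor K X) (f : mor X Y) :=
  f ∘ i = 0 /\
  forall Z (g : mor Z X), f ∘ g = 0 -> exists! u : mor Z K, i ∘ u = g.

Definition is_cokernel X Y Z (f : mor X Y) (p : mor Y Z) :=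
  p ∘ f = 0 /\
  forall T (g : mor Y T), g ∘ f = 0 -> exists! u : mor Z T, u ∘ p = g.

Definition short_exact X Y Z (f : mor X Y) (g : mor Y Z) :=
  is_kernel f g /\ is_cokernel f g.

(* The map induced by [f] into the kernel of [g] exists and is epi. *)
Definition exact_at X Y Z (f : mor X Y) (g : mor Y Z) :=
  exists K (i : mor K Y) (e : mor X K), [/\ is_kernel i g, epi e & i ∘ e = f].

Definition is_coproduct (I : Type) (F : I -> A) S (inj : forall i, mor (F i) S)
  := forall Z (f : forall i, mor (F i) Z),
       exists! u : mor S Z, forall i, u ∘ inj i = f i.

Definition direct_summand Y S :=
  exists Y' (i : mor Y S) (p : mor S Y) (i' : mor Y' S) (p' : mor S Y'),
    [/\ p ∘ i = idm Y, p' ∘ i' = idm Y', p' ∘ i = 0, p ∘ i' = 0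
      & i ∘ p + i' ∘ p' = idm S].

Definition projective X :=
  forall Y Z (g : mor Y Z) (f : mor X Z), epi g ->
    exists h : mor X Y, g ∘ h = f.

(** ... -> P 2 -> P 1 -> P 0 -> X -> 0 *)
Definition projective_resolution X (P : nat -> A)
    (d : forall n, mor (P n.+1) (P n)) (aug : mor (P 0%N) X) :=
  [/\ forall n, projective (P n), epi aug, exact_at (d 0%N) aug
    & forall n, exact_at (d n.+1) (d n)].

(* Ext^(n+1)(X, W) = 0 for Ext the derived functor of Hom: the cohomology of
   Hom(P, W) in degree n + 1 is zero for any projective resolution P of X.
   This is only meaningful in a category with enough projectives, as are the
   module category and the functor category below. *)
Definition ext_zero (n : nat) X W :=
  forall (P : nat -> A) (d : forall m, mor (P m.+1) (P m)) (aug : mor (P 0%N) X),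
    projective_resolution d aug ->
    forall z : mor (P n.+1) W, z ∘ d n.+1 = 0 ->
      exists b : mor (P n) W, z = b ∘ d n.

Implicit Types XX WW : A -> Prop.

(* A full subcategory is given by its class of objects. Finite coproducts
   include the empty one, that is, the zero object. *)
Definition subcategory XX :=
  (forall X Y, isomorphic X Y -> XX X -> XX Y) /\
  (forall (n : nat) (F : 'I_n -> A) S (inj : forall i, mor (F i) S),
     is_coproduct inj -> (forall i, XX (F i)) -> XX S).

Definition closed_under_extensions XX :=
  forall X Y Z (f : mor X Y) (g : mor Y Z),
    short_exact f g -> XX X -> XX Z -> XX Y.

Definition closed_under_kernels_of_epis XX :=
  forall K X Y (i : mor K X) (f : mor X Y),
    epi f -> is_kernel i f -> XX X -> XX Y -> XX K.

Definition closed_under_summands XX :=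
  forall Y S, direct_summand Y S -> XX S -> XX Y.

Definition injective_cogenerator WW XX :=
  [/\ forall X, WW X -> XX X,
      forall X, XX X -> exists W X' (f : mor X W) (g : mor W X'),
        [/\ WW W, XX X' & short_exact f g]
    & forall X W (n : nat), XX X -> WW W -> ext_zero n X W].

Definition left_frobenius_pair XX WW :=
  [/\ subcategory XX /\ subcategory WW,
      closed_under_extensions XX,
      closed_under_kernels_of_epis XX,
      closed_under_summands XX
    & injective_cogenerator WW XX /\ closed_under_summands WW].

End Preadditive.

Lemma linear_ext (R : pzRingType) (U : lmodType R) (V : zmodType)
  (s : R -> V -> V) (f g : {linear U -> V | s}) : f =1 g -> f = g.
Proof.
case: f g => [f [fD fZ]] [g [gD gZ]] /= /funext efg.
case: g / efg gD gZ => gD gZ.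
have -> : fD = gD by case: fD gD => [p] [q]; rewrite (Prop_irrelevance p q).
have -> // : fZ = gZ by case: fZ gZ => [p] [q]; rewrite (Prop_irrelevance p q).
Qed.

(* An alias of {linear M -> N} that carries its group structure. *)
Definition linmap (R : pzRingType) (M N : lmodType R) := {linear M -> N}.

Section LinearMaps.
Variables (R : pzRingType) (M N : lmodType R).
Implicit Types f g h : linmap M N.

HB.instance Definition _ := gen_eqMixin (linmap M N).
HB.instance Definition _ := gen_choiceMixin (linmap M N).

Definition linmap_zero : linmap M N := [the {linear M -> N} of \0].
Definition linmap_opp f : linmap M N := [the {linear M -> N} of \- f].
Definition linmap_add f g : linmap M N := [the {linear M -> N} of f \+ g].

Fact linmap_addA : associative linmap_add.
Proof. by move=> f g h; apply: linear_ext => x /=; rewrite addrA. Qed.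
Fact linmap_addC : commutative linmap_add.
Proof. by move=> f g; apply: linear_ext => x /=; rewrite addrC. Qed.
Fact linmap_add0 : left_id linmap_zero linmap_add.
Proof. by move=> f; apply: linear_ext => x /=; rewrite add0r. Qed.
Fact linmap_addN : left_inverse linmap_zero linmap_opp linmap_add.
Proof. by move=> f; apply: linear_ext => x /=; rewrite addNr. Qed.

HB.instance Definition _ := GRing.isZmodule.Build (linmap M N)
  linmap_addA linmap_addC linmap_add0 linmap_addN.
End LinearMaps.

Definition linmap_id (R : pzRingType) (M : lmodType R) : linmap M M :=
  [the {linear M -> M} of idfun].

Definition linmap_comp (R : pzRingType) (M N L : lmodType R)
  (g : linmap N L) (f : linmap M N) : linmap M L :=
  [the {linear M -> L} of g \o f].

Program Definition Mod (R : pzRingType) : preadditive :=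
  @Preadditive (lmodType R) (fun M N => linmap M N)
    (@linmap_id R) (@linmap_comp R) _ _ _ _ _.
Next Obligation. by move=> R M N f; apply: linear_ext. Qed.
Next Obligation. by move=> R M N f; apply: linear_ext. Qed.
Next Obligation. by move=> R M N L K h g f; apply: linear_ext. Qed.
Next Obligation. by move=> R M N L g g' f; apply: linear_ext. Qed.
Next Obligation.
by move=> R M N L g f f'; apply: linear_ext => x /=; rewrite raddfD.
Qed.

(* [algType k] is not used because it excludes the zero ring. *)
Record kalgebra (k : comPzRingType) := KAlgebra {
  kalg :> pzRingType;
  unit_map : {rmorphism k -> kalg};
  unit_central : forall c (a : kalg), unit_map c * a = a * unit_map c }.

(* Not a [preadditive]: the objects of [Mod R] form a large type, whereas
   those of a [small_klincat] must be small for natural transformations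
   between functors on it to form an abelian group. *)
Record small_klincat (k : comPzRingType) := SmallKlincat {
  ob :> Type;
  chom : ob -> ob -> lmodType k;
  cid : forall p, chom p p;
  ccomp : forall p q r, chom q r -> chom p q -> chom p r;
  ccomp1m : forall p q (f : chom p q), ccomp (cid q) f = f;
  ccompm1 : forall p q (f : chom p q), ccomp f (cid p) = f;
  ccompA : forall p q r s (h : chom r s) (g : chom q r) (f : chom p q),
    ccomp h (ccomp g f) = ccomp (ccomp h g) f;
  ccomp_linl : forall p q r c (g g' : chom q r) (f : chom p q),
    ccomp (c *: g + g') f = c *: ccomp g f + ccomp g' f;
  ccomp_linr : forall p q r c (g : chom q r) (f f' : chom p q),
    ccomp g (c *: f + f') = c *: ccomp g f + ccomp g f' }.

Arguments chom {k C} p q : rename.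
Arguments cid {k C} p : rename.

Definition finitely_generated (k : pzRingType) (V : lmodType k) :=
  exists (n : nat) (e : 'I_n -> V),
    forall v, exists c : 'I_n -> k, v = \sum_(i < n) c i *: e i.

Definition hom_finite (k : comPzRingType) (C : small_klincat k) :=
  forall p q : C,
    finitely_generated (chom p q) /\ projective (chom p q : Mod k).

Definition locally_bounded (k : comPzRingType) (C : small_klincat k) :=
  forall q : C, finite_set [set p : C |
    (exists f : chom p q, f <> 0) \/ (exists f : chom q p, f <> 0)].

Section Functors.
Variables (k : comPzRingType) (A : kalgebra k) (C : small_klincat k).

Record kfunctor := KFunctor {
  fob :> C -> lmodType A;
  fmor : forall p q, chom p q -> linmap (fob p) (fob q);
  fmor_id : forall p x, fmor (cid p) x = x;
  fmor_comp : forall p q r (g : chom q r) (f : chom p q) x,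
    fmor (ccomp g f) x = fmor g (fmor f x);
  fmor_lin : forall p q c (f g : chom p q) x,
    fmor (c *: f + g) x = unit_map A c *: fmor f x + fmor g x }.

Record nat_trans (X Y : kfunctor) := NatTrans {
  ntf :> forall p, linmap (X p) (Y p);
  ntfP : forall p q (f : chom p q) x, ntf q (fmor X f x) = fmor Y f (ntf p x) }.

Lemma nat_trans_ext X Y (s t : nat_trans X Y) :
  (forall p x, s p x = t p x) -> s = t.
Proof.
case: s t => [s sP] [t tP] /= e.
have {}e : s = t by apply/functional_extensionality_dep => p; apply/linear_ext/e.
by case: t / e tP => tP; rewrite (Prop_irrelevance sP tP).
Qed.

Section NatTransGroup.
Variables X Y : kfunctor.
Implicit Types s t u : nat_trans X Y.

HB.instance Definition _ := gen_eqMixin (nat_trans X Y).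
HB.instance Definition _ := gen_choiceMixin (nat_trans X Y).

Program Definition nt_zero : nat_trans X Y := @NatTrans X Y (fun p => 0) _.
Next Obligation. by move=> p q f x /=; rewrite raddf0. Qed.
Program Definition nt_opp s : nat_trans X Y := @NatTrans X Y (fun p => - s p) _.
Next Obligation. by move=> s p q f x /=; rewrite ntfP raddfN. Qed.
Program Definition nt_add s t : nat_trans X Y :=
  @NatTrans X Y (fun p => s p + t p) _.
Next Obligation. by move=> s t p q f x /=; rewrite !ntfP raddfD. Qed.

Fact nt_addA : associative nt_add.
Proof. by move=> s t u; apply: nat_trans_ext => p x /=; rewrite addrA. Qed.
Fact nt_addC : commutative nt_add.
Proof. by move=> s t; apply: nat_trans_ext => p x /=; rewrite addrC. Qed.
Fact nt_add0 : left_id nt_zero nt_add.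
Proof. by move=> s; apply: nat_trans_ext => p x /=; rewrite add0r. Qed.
Fact nt_addN : left_inverse nt_zero nt_opp nt_add.
Proof. by move=> s; apply: nat_trans_ext => p x /=; rewrite addNr. Qed.

HB.instance Definition _ := GRing.isZmodule.Build (nat_trans X Y)
  nt_addA nt_addC nt_add0 nt_addN.
End NatTransGroup.

Program Definition nt_id X : nat_trans X X :=
  @NatTrans X X (fun p => linmap_id (X p)) _.
Next Obligation. by []. Qed.

Program Definition nt_comp X Y Z (t : nat_trans Y Z) (s : nat_trans X Y) :
    nat_trans X Z :=
  @NatTrans X Z (fun p => linmap_comp (t p) (s p)) _.
Next Obligation. by move=> X Y Z t s p q f x /=; rewrite !ntfP. Qed.

Program Definition FunMod : preadditive :=
  @Preadditive kfunctor (fun X Y => nat_trans X Y) nt_id nt_comp _ _ _ _ _.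
Next Obligation. by move=> X Y f; apply: nat_trans_ext. Qed.
Next Obligation. by move=> X Y f; apply: nat_trans_ext. Qed.
Next Obligation. by move=> X Y Z T h g f; apply: nat_trans_ext. Qed.
Next Obligation. by move=> X Y Z g g' f; apply: nat_trans_ext. Qed.
Next Obligation.
by move=> X Y Z g f f'; apply: nat_trans_ext => p x /=; rewrite raddfD.
Qed.

(* Hom_k(V, M): [M] is a k-module through the structure map of [A], and [A]
   acts on maps through its action on values. *)
Definition khom (V : lmodType k) (M : lmodType A) :=
  {linear V -> M | unit_map A \; *:%R}.

Section KHom.
Variables (V : lmodType k) (M : lmodType A).
Implicit Types f g h : khom V M.

HB.instance Definition _ := gen_eqMixin (khom V M).
HB.instance Definition _ := gen_choiceMixin (khom V M).

Local Notation lin := {linear V -> M | unit_map A \; *:%R}.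
Definition khom_zero : khom V M := [the lin of \0].
Definition khom_opp f : khom V M := [the lin of \- f].
Definition khom_add f g : khom V M := [the lin of f \+ g].

Fact khom_addA : associative khom_add.
Proof. by move=> f g h; apply: linear_ext => x /=; rewrite addrA. Qed.
Fact khom_addC : commutative khom_add.
Proof. by move=> f g; apply: linear_ext => x /=; rewrite addrC. Qed.
Fact khom_add0 : left_id khom_zero khom_add.
Proof. by move=> f; apply: linear_ext => x /=; rewrite add0r. Qed.
Fact khom_addN : left_inverse khom_zero khom_opp khom_add.
Proof. by move=> f; apply: linear_ext => x /=; rewrite addNr. Qed.

HB.instance Definition _ := GRing.isZmodule.Build (khom V M)
  khom_addA khom_addC khom_add0 khom_addN.

Fact khom_scale_subproof (a : A) f :
  linear_for (unit_map A \; *:%R) (fun v => a *: f v).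
Proof. by move=> c u v; rewrite linearP scalerDr /= !scalerA unit_central. Qed.

Definition khom_scale (a : A) f : khom V M :=
  HB.pack (fun v => a *: f v)
    (GRing.isLinear.Build _ _ _ _ _ (khom_scale_subproof a f)).

Fact khom_scaleA a b f : khom_scale a (khom_scale b f) = khom_scale (a * b) f.
Proof. by apply: linear_ext => x /=; rewrite scalerA. Qed.
Fact khom_scale1 : left_id 1 khom_scale.
Proof. by move=> f; apply: linear_ext => x /=; rewrite scale1r. Qed.
Fact khom_scaleDr : right_distributive khom_scale +%R.
Proof. by move=> a f g; apply: linear_ext => x /=; rewrite scalerDr. Qed.
Fact khom_scaleDl f : {morph khom_scale^~ f : a b / a + b}.
Proof. by move=> a b; apply: linear_ext => x /=; rewrite scalerDl. Qed.

HB.instance Definition _ := GRing.Zmodule_isLmodule.Build A (khom V M)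
  khom_scaleA khom_scale1 khom_scaleDr khom_scaleDl.
End KHom.

(* G_q(M) = Hom_k(C(-, q), M), with f : p -> p' acting by
   h |-> (g |-> h (g o f)). *)
Section G.
Variables (q : C) (M : lmodType A).

Fact Gfun_precomp_subproof p p' (f : chom p p') (h : khom (chom p q) M) :
  linear_for (unit_map A \; *:%R) (fun g : chom p' q => h (ccomp g f)).
Proof. by move=> c g g'; rewrite ccomp_linl linearP. Qed.

Definition Gfun_precomp p p' (f : chom p p') (h : khom (chom p q) M) :
    khom (chom p' q) M :=
  HB.pack (fun g : chom p' q => h (ccomp g f))
    (GRing.isLinear.Build _ _ _ _ _ (Gfun_precomp_subproof f h)).

Fact Gfun_map_subproof p p' (f : chom p p') : linear (Gfun_precomp f).
Proof. by move=> a h h'; apply: linear_ext. Qed.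

Definition Gfun_map p p' (f : chom p p') :
    linmap (khom (chom p q) M) (khom (chom p' q) M) :=
  HB.pack (Gfun_precomp f) (GRing.isLinear.Build _ _ _ _ _ (Gfun_map_subproof f)).

Program Definition Gfun : kfunctor :=
  @KFunctor (fun p => khom (chom p q) M) Gfun_map _ _ _.
Next Obligation.
by move=> p h; apply: linear_ext => g /=; rewrite ccompm1.
Qed.
Next Obligation.
by move=> p p' p'' g f h; apply: linear_ext => u /=; rewrite ccompA.
Qed.
Next Obligation.
by move=> p p' c f g h; apply: linear_ext => u /=; rewrite ccomp_linr linearP.
Qed.
End G.

Definition fun_in (XX : Mod A -> Prop) : FunMod -> Prop :=
  fun X : kfunctor => forall q, XX (X q).

Definition tilde (XX : Mod A -> Prop) : FunMod -> Prop := fun Y =>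
  exists (N : C -> Mod A) (S : FunMod) (inj : forall q, mor (Gfun q (N q) : FunMod) S),
    [/\ forall q, XX (N q), is_coproduct inj & direct_summand Y S].

End Functors.

(* Main.v *)
Require Import Defs.
From mathcomp Require Import all_boot all_algebra.
From HB Require Import structures.
From mathcomp Require Import boolp classical_sets cardinality.

(** Kernels, cokernels, epimorphisms and finite coproducts of functors are
    computed object by object, because pointwise kernels and quotients are
    again functors.  So the closure properties of [XX] pass to [fun_in XX] by
    evaluation, and what is left concerns the functors [G_q].

    Local boundedness makes the family [G_q (N q)] locally finite: at an object
    [p] only those [q] with a nonzero map [p -> q] contribute.  Hence its
    coproduct is the pointwise product [G_product N] ([G_product_coproduct]),
    and [tilde WW] consists of the retracts of the functors [G_product N] with
    all [N q] in [WW] ([tilde_retract]).  At each object [G_product N] is a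
    finite sum of modules [Hom_k(C(p,q), N q)], and each of these is a retract
    of a finite power of [N q] because [C(p,q)] has a finite dual basis
    ([khom_retract_power]); so [G_product N] takes values in [XX] as soon as
    all [N q] are in [XX] ([G_product_closed]).

    Cogeneration ([fun_in_cogenerated]).  Choose short exact sequences
    [0 -> X q -> W q -> T q -> 0] for [XX].  The unit [X -> G_product X] followed
    by [G_product X -> G_product W] is a monomorphism.  At each object the unit
    splits, by evaluation at an identity, and [G_product] is exact since the
    [C(p,q)] are projective.  The cokernel of the composite is therefore an
    extension of [G_product T p] by a summand of [G_product X p], which are both
    in [XX] ([cokernel_of_retract_closed]).

    Vanishing of Ext ([tilde_ext_zero]).  Evaluation at [q] is exact, and it
    preserves projectives because its right adjoint [G_q] preserves epimorphisms
    ([eval_projective]).  So it maps a projective resolution of [X] to one of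
    [X q], and a cocycle with values in [G_product N] is, by adjunction, a
    family of cocycles with values in the modules [N q], each of which bounds
    because [Ext(X q, N q) = 0]. *)

Set Implicit Arguments.
Unset Strict Implicit.
Unset Printing Implicit Defensive.
Import GRing.Theory.
Local Open Scope ring_scope.
Local Obligation Tactic := idtac.

Local Notation "g ∘ f" := (compm g f) (at level 40, left associativity).

Lemma dependent_choice (I : Type) (T : I -> Type) (P : forall i, T i -> Prop) :
  (forall i, exists x, P i x) -> {f : forall i, T i | forall i, P i (f i)}.
Proof. by move=> ex; apply: (all_sig (fun i => cid (ex i))). Qed.

(** * Retracts and biproducts in a preadditive category *)

Section Preadditive.
Variable B : preadditive.
Implicit Types X Y Z K S T : B.

Lemma comp0m X Y Z (f : mor X Y) : (0 : mor Y Z) ∘ f = 0.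
Proof. by apply: (addrI (0 ∘ f)); rewrite -compDl !addr0. Qed.

Lemma compm0 X Y Z (g : mor Y Z) : g ∘ (0 : mor X Y) = 0.
Proof. by apply: (addrI (g ∘ 0)); rewrite -compDr !addr0. Qed.

Lemma compNm X Y Z (g : mor Y Z) (f : mor X Y) : (- g) ∘ f = - (g ∘ f).
Proof. by apply: (addrI (g ∘ f)); rewrite -compDl !subrr comp0m. Qed.

Lemma compmN X Y Z (g : mor Y Z) (f : mor X Y) : g ∘ (- f) = - (g ∘ f).
Proof. by apply: (addrI (g ∘ f)); rewrite -compDr !subrr compm0. Qed.

Lemma compm_suml X Y Z n (g : 'I_n -> mor Y Z) (f : mor X Y) :
  (\sum_i g i) ∘ f = \sum_i g i ∘ f.
Proof.
by rewrite (big_morph (fun h => h ∘ f) (fun g g' => compDl g g' f) (comp0m Z f)).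
Qed.

Lemma compm_sumr X Y Z n (g : mor Y Z) (f : 'I_n -> mor X Y) :
  g ∘ (\sum_i f i) = \sum_i g ∘ f i.
Proof. by rewrite (big_morph (compm g) (compDr g) (compm0 X g)). Qed.

(** Unlike [direct_summand], this asks for no complement, so that it composes
    without having to build one. *)
Definition retract Y S := exists (i : mor Y S) (p : mor S Y), p ∘ i = idm Y.

Lemma retract_refl X : retract X X.
Proof. by exists (idm X), (idm X); rewrite comp1m. Qed.

Lemma retract_trans X Y Z : retract X Y -> retract Y Z -> retract X Z.
Proof.
move=> [i [p pi]] [j [q qj]]; exists (j ∘ i), (p ∘ q).
by rewrite compmA -(compmA p) qj compm1.
Qed.

Lemma isomorphic_retract X Y : isomorphic X Y -> retract X Y /\ retract Y X.
Proof. by move=> [f [g [gf fg]]]; split; [exists f, g | exists g, f]. Qed.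

Lemma summand_retract Y S : direct_summand Y S -> retract Y S.
Proof. by move=> [Y' [i [p [i' [p' [pi _ _ _ _]]]]]]; exists i, p. Qed.

Lemma kernel_monic K X Y (i : mor K X) (f : mor X Y) :
  is_kernel i f -> forall Z (g h : mor Z K), i ∘ g = i ∘ h -> g = h.
Proof.
move=> [fi univ] Z g h e.
have fih : f ∘ (i ∘ h) = 0 by rewrite compmA fi comp0m.
by have [u [_ uu]] := univ _ _ fih; rewrite -(uu g e) -(uu h erefl).
Qed.

(** The complement is the kernel of the retraction [p]: the idempotent
    [1 - i p] factors through it. *)
Lemma retract_summand :
  (forall X Y (f : mor X Y), exists K (i : mor K X), is_kernel i f) ->
  forall Y S, retract Y S -> direct_summand Y S.
Proof.
move=> has_ker Y S [i [p pi]]; have [K [i' ker]] := has_ker _ _ p.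
have [pi' univ] := ker.
have : p ∘ (idm S - i ∘ p) = 0.
  by rewrite compDr compmN compmA pi comp1m compm1 subrr.
move=> /univ[p' [i'p' _]]; exists K, i, p, i', p'; split => //.
- apply: (kernel_monic ker); rewrite compmA i'p' compDl compNm -compmA pi'.
  by rewrite compm0 subr0 comp1m compm1.
- apply: (kernel_monic ker); rewrite compmA i'p' compDl compNm -compmA pi.
  by rewrite comp1m !compm1 subrr compm0.
- by rewrite i'p' addrC subrK.
Qed.

Lemma kernel_unique K K' X Y (i : mor K X) (i' : mor K' X) (f : mor X Y) :
  is_kernel i f -> is_kernel i' f ->
  exists (u : mor K K') (v : mor K' K),
    [/\ i' ∘ u = i, i ∘ v = i', v ∘ u = idm K & u ∘ v = idm K'].
Proof.
move=> k k'; have [u [iu _]] := k'.2 _ _ k.1; have [v [iv _]] := k.2 _ _ k'.1.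
exists u, v; split => //.
  by apply: (kernel_monic k); rewrite compmA iv iu compm1.
by apply: (kernel_monic k'); rewrite compmA iu iv compm1.
Qed.

Lemma cokernel_epi X Y Z (f : mor X Y) (p : mor Y Z) : is_cokernel f p -> epi p.
Proof.
move=> [pf univ] T g h e.
have hpf : (h ∘ p) ∘ f = 0 by rewrite -compmA pf compm0.
by have [u [_ uu]] := univ _ _ hpf; rewrite -(uu g e) -(uu h erefl).
Qed.

Lemma cokernel_unique X Y Z Z' (f : mor X Y) (p : mor Y Z) (p' : mor Y Z') :
  is_cokernel f p -> is_cokernel f p' ->
  exists (u : mor Z Z') (v : mor Z' Z),
    [/\ u ∘ p = p', v ∘ p' = p, v ∘ u = idm Z & u ∘ v = idm Z'].
Proof.
move=> c c'; have [u [up _]] := c.2 _ _ c'.1; have [v [vp _]] := c'.2 _ _ c.1.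
exists u, v; split => //.
  by apply: (cokernel_epi c); rewrite -compmA up vp comp1m.
by apply: (cokernel_epi c'); rewrite -compmA vp up comp1m.
Qed.

Section Biproduct.
Variables (n : nat) (F : 'I_n -> B) (S : B).
Variables (inj : forall i, mor (F i) S) (proj : forall i, mor S (F i)).

Definition is_biproduct :=
  [/\ forall i, proj i ∘ inj i = idm (F i),
      forall i j, i <> j -> proj j ∘ inj i = 0
    & \sum_i inj i ∘ proj i = idm S].

Lemma biproduct_coproduct : is_biproduct -> is_coproduct inj.
Proof.
move=> [pi1 pi0 sum1] Z f; exists (\sum_i f i ∘ proj i); split.
  move=> i; rewrite compm_suml (bigD1 i) //= -compmA pi1 compm1 big1 ?addr0 //.
  by move=> j /eqP ji; rewrite -compmA pi0 ?compm0 // => ij; apply: ji.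
move=> u ui; rewrite -[u]compm1 -sum1 compm_sumr.
by apply: eq_bigr => i _; rewrite compmA ui.
Qed.

Lemma retract_of_biproduct T (a : forall i, mor (F i) T)
    (b : forall i, mor T (F i)) :
  is_biproduct -> (forall i, b i ∘ a i = idm (F i)) ->
  (forall i j, i <> j -> b j ∘ a i = 0) -> retract S T.
Proof.
move=> [pi1 pi0 sum1] ba1 ba0.
exists (\sum_i a i ∘ proj i), (\sum_j inj j ∘ b j).
rewrite compm_suml -sum1; apply: eq_bigr => j _.
rewrite compm_sumr (bigD1 j) //= big1 ?addr0.
  by rewrite compmA -(compmA (inj j)) ba1 compm1.
move=> i /eqP ij; rewrite compmA -(compmA (inj j)) ba0 ?compm0 ?comp0m //.
Qed.

End Biproduct.

Lemma coproduct_biproduct n (F : 'I_n -> B) S (inj : forall i, mor (F i) S) :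
  is_coproduct inj -> exists proj, is_biproduct inj proj.
Proof.
move=> cop.
(* the Kronecker symbol, a dependent one since its type varies with [i] and [j] *)
pose delta j i : mor (F i) (F j) :=
  if pselect (i = j) is left e then eq_rect i (fun l => mor (F i) (F l)) (idm _) j e
  else 0.
have [proj projP] := dependent_choice (fun j => cop _ (delta j)).
have proj_inj j i : proj j ∘ inj i = delta j i by apply: (projP j).1.
exists proj; split.
- move=> i; rewrite proj_inj /delta; case: pselect => // e.
  by rewrite (Prop_irrelevance e erefl).
- by move=> i j ij; rewrite proj_inj /delta; case: pselect.
(* both sides restrict to [inj i] on each summand *)
have [u [_ uu]] := cop _ inj.
rewrite -(uu (idm S)) => [|i]; last by rewrite comp1m.
apply/esym/uu => i; rewrite compm_suml (bigD1 i) //= big1 ?addr0.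
  rewrite -compmA proj_inj /delta; case: pselect => // e.
  by rewrite (Prop_irrelevance e erefl) /= compm1.
move=> j /eqP ji; rewrite -compmA proj_inj /delta; case: pselect => [/esym//|_].
by rewrite compm0.
Qed.

Lemma coproduct_unique (I : Type) (F : I -> B) S S'
    (inj : forall i, mor (F i) S) (inj' : forall i, mor (F i) S') :
  is_coproduct inj -> is_coproduct inj' -> isomorphic S S'.
Proof.
move=> c c'; have [u [ui _]] := c _ inj'; have [v [vi _]] := c' _ inj.
exists u, v; split.
  have [w [_ ww]] := c _ inj.
  rewrite -(ww (idm S)) => [|i]; last by rewrite comp1m.
  by apply/esym/ww => i; rewrite -compmA ui vi.
have [w [_ ww]] := c' _ inj'.
rewrite -(ww (idm S')) => [|i]; last by rewrite comp1m.
by apply/esym/ww => i; rewrite -compmA vi ui.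
Qed.

End Preadditive.

(** * Products of modules *)

Section LinearMapConstruction.
Variables (R : pzRingType) (M N : lmodType R) (f : M -> N) (f_lin : linear f).
Definition mk_linmap : linmap M N :=
  HB.pack f (GRing.isLinear.Build _ _ _ _ _ f_lin).
End LinearMapConstruction.

Lemma linmap_sumE (R : pzRingType) (M N : lmodType R) n
    (f : 'I_n -> linmap M N) x : (\sum_i f i) x = \sum_i f i x.
Proof. by apply: (big_morph (fun h : linmap M N => h x)). Qed.

Section DependentProduct.
Variables (R : pzRingType) (I : Type) (F : I -> lmodType R).

Definition dprod : Type := forall i, F i.
Implicit Types x y : dprod.

HB.instance Definition _ := gen_eqMixin dprod.
HB.instance Definition _ := gen_choiceMixin dprod.

Lemma dprod_ext x y : (forall i, x i = y i) -> x = y.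
Proof. exact: functional_extensionality_dep. Qed.

Fact dprod_addA : associative (fun x y : dprod => (fun i => x i + y i) : dprod).
Proof. by move=> x y z; apply: dprod_ext => i; rewrite addrA. Qed.
Fact dprod_addC : commutative (fun x y : dprod => (fun i => x i + y i) : dprod).
Proof. by move=> x y; apply: dprod_ext => i; rewrite addrC. Qed.
Fact dprod_add0 : left_id ((fun=> 0) : dprod) (fun x y i => x i + y i).
Proof. by move=> x; apply: dprod_ext => i; rewrite add0r. Qed.
Fact dprod_addN :
  left_inverse ((fun=> 0) : dprod) (fun x i => - x i) (fun x y i => x i + y i).
Proof. by move=> x; apply: dprod_ext => i; rewrite addNr. Qed.

HB.instance Definition _ := GRing.isZmodule.Build dprod
  dprod_addA dprod_addC dprod_add0 dprod_addN.

Definition dprod_scale (a : R) x : dprod := fun i => a *: x i.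
Fact dprod_scaleA a b x : dprod_scale a (dprod_scale b x) = dprod_scale (a * b) x.
Proof. by apply: dprod_ext => i; apply: scalerA. Qed.
Fact dprod_scale1 : left_id 1 dprod_scale.
Proof. by move=> x; apply: dprod_ext => i; apply: scale1r. Qed.
Fact dprod_scaleDr : right_distributive dprod_scale +%R.
Proof. by move=> a x y; apply: dprod_ext => i; apply: scalerDr. Qed.
Fact dprod_scaleDl x : {morph dprod_scale^~ x : a b / a + b}.
Proof. by move=> a b; apply: dprod_ext => i; apply: scalerDl. Qed.

HB.instance Definition _ := GRing.Zmodule_isLmodule.Build R dprod
  dprod_scaleA dprod_scale1 dprod_scaleDr dprod_scaleDl.

Fact dproj_linear i : linear (fun x : dprod => x i).
Proof. by []. Qed.
Definition dproj i : linmap dprod (F i) := mk_linmap (dproj_linear i).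

Lemma dprod_sumE n (x : 'I_n -> dprod) i : (\sum_j x j) i = \sum_j x j i.
Proof. exact: (linear_sum (dproj i)). Qed.

Definition dpair (M : lmodType R) (f : forall i, linmap M (F i)) (m : M) : dprod :=
  fun i => f i m.
Fact dpair_linear M (f : forall i, linmap M (F i)) : linear (dpair f).
Proof. by move=> a x y; apply: dprod_ext => i; apply: linearP. Qed.
Definition dpairing M (f : forall i, linmap M (F i)) : linmap M dprod :=
  mk_linmap (dpair_linear f).

(** Equality of indices is decided classically, so that [I] may be any type; the
    objects of a category come without a decidable equality. *)
Definition dinj_fun i (y : F i) : dprod := fun j =>
  if pselect (i = j) is left e then eq_rect i (fun j => F j : Type) y j e else 0.
Fact dinj_linear i : linear (@dinj_fun i).
Proof.
move=> a x y; apply: dprod_ext => j; rewrite /dinj_fun /=.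
have -> z z' : (a *: z + z' : dprod) j = a *: z j + z' j by [].
by case: pselect => [e|_]; [case: j / e | rewrite scaler0 addr0].
Qed.
Definition dinj i : linmap (F i) dprod := mk_linmap (@dinj_linear i).

Lemma dinj_same i (y : F i) : dinj i y i = y.
Proof.
rewrite /= /dinj_fun; case: pselect => // e.
by rewrite (Prop_irrelevance e erefl).
Qed.

Lemma dinj_diff i j (y : F i) : i <> j -> dinj i y j = 0.
Proof. by rewrite /= /dinj_fun; case: pselect. Qed.

Lemma dprod_decomp n (e : 'I_n -> I) (x : dprod) : injective e ->
  (forall i, (forall j, e j <> i) -> x i = 0) ->
  x = \sum_j dinj (e j) (x (e j)).
Proof.
move=> e_inj triv; apply: dprod_ext => i; rewrite dprod_sumE.
have [[j <-]|ne] := pselect (exists j, e j = i).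
  rewrite (bigD1 j) // dinj_same big1 => [|l]; first exact/esym/addr0.
  by move=> /eqP lj; rewrite dinj_diff // => /e_inj.
have ei j : e j <> i by move=> ej; apply: ne; exists j.
by rewrite triv // big1 // => j _; rewrite dinj_diff.
Qed.

(** The inclusion [e] is kept general in order to discard the zero factors of an
    infinite product; the identity gives finite products. *)
Lemma dprod_biproduct n (e : 'I_n -> I) : injective e ->
  (forall i, (forall j, e j <> i) -> forall y : F i, y = 0) ->
  @is_biproduct (Mod R) n (fun j => F (e j)) dprod
    (fun j => dinj (e j)) (fun j => dproj (e j)).
Proof.
move=> e_inj triv; split.
- by move=> j; apply: linear_ext => y; apply: dinj_same.
- by move=> i j ij; apply: linear_ext => y; apply: dinj_diff => /e_inj.
apply: linear_ext => x.
rewrite [LHS](linmap_sumE (fun j => linmap_comp (dinj (e j)) (dproj (e j)))).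
by rewrite -dprod_decomp // => i /triv; apply.
Qed.

End DependentProduct.

(** * Kernels and cokernels of linear maps *)

Section Kernel.
Variables (R : pzRingType) (M N : lmodType R) (f : linmap M N).

Definition in_ker : pred M := fun x => f x == 0.
Definition ker_mod : Type := {x : M | in_ker x}.

Fact in_ker_closed : subsemimod_closed in_ker.
Proof.
split; [split|].
- by rewrite unfold_in /in_ker linear0.
- move=> x y; rewrite !unfold_in /in_ker => /eqP fx /eqP fy.
  by rewrite linearD fx fy addr0.
- move=> a x; rewrite !unfold_in /in_ker => /eqP fx.
  by rewrite linearZ_LR fx scaler0.
Qed.

HB.instance Definition _ := SubChoice.on ker_mod.
HB.instance Definition _ :=
  GRing.SubChoice_isSubLmodule.Build R M in_ker ker_mod in_ker_closed.

Fact ker_incl_linear : linear (fun x : ker_mod => val x).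
Proof. by move=> a x y; rewrite linearD linearZ. Qed.
Definition ker_incl : linmap ker_mod M := mk_linmap ker_incl_linear.

Lemma ker_inclP x : f (ker_incl x) = 0.
Proof. exact/eqP/(valP x). Qed.

Definition ker_mk (x : M) (fx : f x = 0) : ker_mod := exist _ x (introT eqP fx).

End Kernel.

Section Cokernel.
Variables (R : pzRingType) (M N : lmodType R) (f : linmap M N).

Definition same_class (x y : N) : Prop := exists m, y - x = f m.

(** The elements of the quotient by the image of [f] are the elements of [N] that
    represent their own class. *)
Definition class_repr (x : N) : N := choose (fun y => `[< same_class x y >]) x.

Lemma class_reprP x : same_class x (class_repr x).
Proof.
apply/asboolP; apply: (@chooseP _ (fun y => `[< same_class x y >])); apply/asboolP.
by exists 0; rewrite subrr linear0.
Qed.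

Lemma class_repr_eq x y : same_class x y -> class_repr x = class_repr y.
Proof.
move=> [m xy]; rewrite /class_repr (@choose_id _ _ x y).
- apply: eq_choose => z; apply: asbool_equiv_eq; split=> [] [m' e].
    by exists (m' - m); rewrite linearB -e -xy opprB addrA subrK.
  by exists (m' + m); rewrite linearD -e -xy addrA subrK.
- by apply/asboolP; exists 0; rewrite subrr linear0.
- by apply/asboolP; exists m.
Qed.

Lemma class_repr_id x : class_repr (class_repr x) = class_repr x.
Proof. exact/esym/class_repr_eq/class_reprP. Qed.

Definition coker_mod : Type := {x : N | class_repr x == x}.
HB.instance Definition _ := Choice.on coker_mod.

Definition to_coker (x : N) : coker_mod :=
  exist _ (class_repr x) (introT eqP (class_repr_id x)).

Lemma to_coker_eq x y : (to_coker x = to_coker y) <-> same_class x y.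
Proof.
split=> [[e]|/class_repr_eq e]; last exact: val_inj.
have [m xm] := class_reprP x; have [m' ym'] := class_reprP y.
exists (m - m'); rewrite linearB -xm -ym' e opprB [RHS]addrC addrA.
by rewrite subrK.
Qed.

Lemma to_coker_val (x : coker_mod) : to_coker (val x) = x.
Proof. by apply: val_inj; apply/eqP/(valP x). Qed.

Lemma coker_ind (P : coker_mod -> Prop) : (forall x, P (to_coker x)) -> forall u, P u.
Proof. by move=> Px u; rewrite -(to_coker_val u). Qed.

Definition coker_add (u v : coker_mod) := to_coker (val u + val v).
Definition coker_opp (u : coker_mod) := to_coker (- val u).
Definition coker_scale (a : R) (u : coker_mod) := to_coker (a *: val u).

Fact to_cokerD x y : coker_add (to_coker x) (to_coker y) = to_coker (x + y).
Proof.
apply/esym/to_coker_eq; have [m xm] := class_reprP x; have [m' ym'] := class_reprP y.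
by exists (m + m'); rewrite linearD -xm -ym' opprD addrACA.
Qed.
Fact to_cokerN x : coker_opp (to_coker x) = to_coker (- x).
Proof.
apply/esym/to_coker_eq; have [m xm] := class_reprP x.
by exists (- m); rewrite (linearN f) -xm opprD.
Qed.
Fact to_cokerZ a x : coker_scale a (to_coker x) = to_coker (a *: x).
Proof.
apply/esym/to_coker_eq; have [m xm] := class_reprP x.
by exists (a *: m); rewrite (linearZ_LR f) -xm scalerBr.
Qed.

Fact coker_addA : associative coker_add.
Proof. by do 3![elim/coker_ind => ?]; rewrite !to_cokerD addrA. Qed.
Fact coker_addC : commutative coker_add.
Proof. by do 2![elim/coker_ind => ?]; rewrite !to_cokerD addrC. Qed.
Fact coker_add0 : left_id (to_coker 0) coker_add.
Proof. by elim/coker_ind => ?; rewrite to_cokerD add0r. Qed.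
Fact coker_addN : left_inverse (to_coker 0) coker_opp coker_add.
Proof. by elim/coker_ind => ?; rewrite to_cokerN to_cokerD addNr. Qed.

HB.instance Definition _ := GRing.isZmodule.Build coker_mod
  coker_addA coker_addC coker_add0 coker_addN.

Fact to_coker_add x y : to_coker x + to_coker y = to_coker (x + y).
Proof. exact: to_cokerD. Qed.

Fact coker_scaleA a b u : coker_scale a (coker_scale b u) = coker_scale (a * b) u.
Proof. by elim/coker_ind: u => ?; rewrite !to_cokerZ scalerA. Qed.
Fact coker_scale1 : left_id 1 coker_scale.
Proof. by elim/coker_ind => ?; rewrite to_cokerZ scale1r. Qed.
Fact coker_scaleDr : right_distributive coker_scale +%R.
Proof.
move=> a; do 2![elim/coker_ind => ?].
by rewrite to_coker_add !to_cokerZ to_coker_add scalerDr.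
Qed.
Fact coker_scaleDl u : {morph coker_scale^~ u : a b / a + b}.
Proof.
elim/coker_ind: u => x a b; rewrite !to_cokerZ to_coker_add.
by rewrite scalerDl.
Qed.

HB.instance Definition _ := GRing.Zmodule_isLmodule.Build R coker_mod
  coker_scaleA coker_scale1 coker_scaleDr coker_scaleDl.

Fact coker_proj_linear : linear to_coker.
Proof. by move=> a x y; rewrite -to_coker_add -to_cokerZ. Qed.
Definition coker_proj : linmap N coker_mod := mk_linmap coker_proj_linear.

Lemma coker_proj_surj u : exists y, coker_proj y = u.
Proof. by elim/coker_ind: u => y; exists y. Qed.

Lemma coker_proj_eq0 y : coker_proj y = 0 <-> exists x, f x = y.
Proof.
split=> [/to_coker_eq[m]|[x <-]]; last first.
  by apply/to_coker_eq; exists (- x); rewrite sub0r linearN.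
by rewrite sub0r => fm; exists (- m); rewrite linearN -fm opprK.
Qed.

End Cokernel.

(** * Exactness on elements *)

Section ElementwiseExactness.
Variable R : pzRingType.
Implicit Types K L M N X Y Z : lmodType R.

Definition surjective_map (T U : Type) (f : T -> U) := forall y, exists x, f x = y.

Definition left_exact K X Y (i : linmap K X) (f : linmap X Y) :=
  injective i /\ forall y, f y = 0 <-> exists x, i x = y.

Definition right_exact X Y Z (f : linmap X Y) (p : linmap Y Z) :=
  surjective_map p /\ forall y, p y = 0 <-> exists x, f x = y.

Lemma ker_left_exact M N (f : linmap M N) : left_exact (ker_incl f) f.
Proof.
split; first exact: val_inj.
by move=> y; split=> [fy|[x <-]]; [exists (ker_mk fy) | apply: ker_inclP].
Qed.

Lemma coker_right_exact M N (f : linmap M N) : right_exact f (coker_proj f).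
Proof. by split; [apply: coker_proj_surj | apply: coker_proj_eq0]. Qed.

(** With [linmap_descend], this gives the universal properties of all kernels and
    cokernels below without a construction of the mediating map: linearity, and
    later naturality, can be tested after an injection or before a surjection. *)
Lemma linmap_factor K X Z (i : linmap K X) (g : linmap Z X) :
  injective i -> (forall z, exists x, i x = g z) ->
  exists u : linmap Z K, forall z, i (u z) = g z.
Proof.
move=> i_inj /choice[u iu].
have u_lin : linear u by move=> a x y; apply: i_inj; rewrite linearP !iu linearP.
by exists (mk_linmap u_lin).
Qed.

Lemma linmap_descend Y Z T (p : linmap Y Z) (g : linmap Y T) :
  surjective_map p -> (forall y, p y = 0 -> g y = 0) ->
  exists u : linmap Z T, forall y, u (p y) = g y.
Proof.
move=> /choice[r pr] gp.
have rp y : g (r (p y)) = g y.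
  by apply/eqP; rewrite -subr_eq0 -linearB gp // linearB pr subrr.
have u_lin : linear (g \o r).
  by move=> a x y /=; rewrite -{1}(pr x) -{1}(pr y) -linearP rp linearP.
by exists (mk_linmap u_lin).
Qed.

(** Stated with elements rather than composites, so that it serves both for linear
    maps and for the components of natural transformations. *)
Lemma left_exact_iso K K' X Y (i : linmap K X) (i' : linmap K' X) (f : linmap X Y)
    (u : linmap K K') (v : linmap K' K) :
  (forall x, i' (u x) = i x) -> (forall x, i (v x) = i' x) ->
  (forall x, v (u x) = x) -> left_exact i' f -> left_exact i f.
Proof.
move=> iu iv vu [i'_inj ex]; split.
  by move=> x y; rewrite -!iu => /i'_inj e; rewrite -(vu x) e vu.
move=> y; rewrite ex; split=> [] [x <-]; last by exists (u x).
by exists (v x).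
Qed.

Lemma right_exact_iso X Y Z Z' (f : linmap X Y) (p : linmap Y Z) (p' : linmap Y Z')
    (u : linmap Z Z') (v : linmap Z' Z) :
  (forall y, u (p y) = p' y) -> (forall y, v (p' y) = p y) ->
  (forall z, v (u z) = z) -> right_exact f p' -> right_exact f p.
Proof.
move=> up vp vu [p'_surj ex]; split.
  by move=> z; have [y py] := p'_surj (u z); exists y; rewrite -vp py vu.
by move=> y; rewrite -ex; split=> e; [rewrite -up | rewrite -vp]; rewrite e linear0.
Qed.

End ElementwiseExactness.

Section ModuleCategory.
Variable R : pzRingType.

Lemma left_exact_kernel (K X Y : Mod R) (i : mor K X) (f : mor X Y) :
  left_exact i f -> is_kernel i f.
Proof.
move=> [i_inj ex]; split; first by apply: linear_ext => x; apply/ex; exists x.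
move=> Z g fg; have [z|u iu] := @linmap_factor R K X Z i g i_inj.
  by apply/ex; apply: (congr1 (fun h : linmap Z Y => h z) fg).
exists u; split; first exact: linear_ext.
by move=> v iv; apply: linear_ext => z; apply: i_inj; rewrite iu -iv.
Qed.

Lemma right_exact_cokernel (X Y Z : Mod R) (f : mor X Y) (p : mor Y Z) :
  right_exact f p -> is_cokernel f p.
Proof.
move=> [p_surj ex]; split; first by apply: linear_ext => x; apply/ex; exists x.
move=> T g gf; have [y|u up] := @linmap_descend R Y Z T p g p_surj.
  by move=> /ex[x <-]; apply: (congr1 (fun h : linmap X T => h x) gf).
exists u; split; first exact: linear_ext.
by move=> v vp; apply: linear_ext => z; have [y <-] := p_surj z; rewrite up -vp.
Qed.

(** An arbitrary kernel is isomorphic to the submodule [ker_mod], on which exactness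
    is visible. *)
Lemma kernel_left_exact (K X Y : Mod R) (i : mor K X) (f : mor X Y) :
  is_kernel i f -> left_exact i f.
Proof.
move=> ker; have ex := ker_left_exact f.
have [u [v [iu iv vu _]]] := kernel_unique ker (left_exact_kernel ex).
apply: (left_exact_iso (u := u) (v := v)) ex => x; first by rewrite -iu.
  by rewrite -iv.
exact: (congr1 (fun h : linmap K K => h x) vu).
Qed.

Lemma cokernel_right_exact (X Y Z : Mod R) (f : mor X Y) (p : mor Y Z) :
  is_cokernel f p -> right_exact f p.
Proof.
move=> coker; have ex := coker_right_exact f.
have [u [v [up vp vu _]]] := cokernel_unique coker (right_exact_cokernel ex).
apply: (right_exact_iso (u := u) (v := v)) ex => y; first by rewrite -up.
  by rewrite -vp.
exact: (congr1 (fun h : linmap Z Z => h y) vu).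
Qed.

Lemma surjective_epi (X Y : Mod R) (f : linmap X Y) :
  surjective_map f -> @epi (Mod R) X Y f.
Proof.
move=> f_surj Z g h e; apply: linear_ext => y; have [x <-] := f_surj y.
exact: (congr1 (fun h : linmap X Z => h x) e).
Qed.

(** An epimorphism cannot tell the projection onto its cokernel from zero. *)
Lemma epi_surjective (X Y : Mod R) (f : linmap X Y) :
  @epi (Mod R) X Y f -> surjective_map f.
Proof.
move=> f_epi y; apply/coker_proj_eq0.
suff -> : coker_proj f = 0 by [].
apply: (f_epi (coker_mod f : lmodType R)); apply: linear_ext => x.
by apply/coker_proj_eq0; exists x.
Qed.

Lemma Mod_retract_summand (Y S : Mod R) : retract Y S -> direct_summand Y S.
Proof.
apply: retract_summand => U V f.
by exists (ker_mod f : lmodType R), (ker_incl f); apply: left_exact_kernel; apply: ker_left_exact.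
Qed.

Lemma short_exact_elementwise (X Y Z : Mod R) (f : mor X Y) (g : mor Y Z) :
  injective (f : linmap X Y) -> right_exact f g -> short_exact f g.
Proof.
move=> f_inj ex; split; last exact: right_exact_cokernel.
by apply: left_exact_kernel; split; last exact: ex.2.
Qed.

End ModuleCategory.

(** * Exactness in the functor category is pointwise *)

Section FunctorCategory.
Variables (k : comPzRingType) (A : kalgebra k) (C : small_klincat k).
Local Notation kfun := (kfunctor A C).
Local Notation FunMod := (FunMod A C).

(** Structure maps of a subfunctor are the restrictions of those of [X]; they
    inherit functoriality because the inclusions are injective. *)
Section SubFunctor.
Variables (X : kfun) (K : C -> lmodType A) (i : forall p, linmap (K p) (X p)).
Hypothesis i_inj : forall p, injective (i p).
Hypothesis i_stable : forall p q (f : chom p q) x, exists y, i q y = fmor X f (i p x).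

Definition sub_fmor p q (f : chom p q) : linmap (K p) (K q) :=
  projT1 (cid (linmap_factor (g := linmap_comp (fmor X f) (i p)) (@i_inj q) (i_stable f))).

Lemma sub_fmorE p q (f : chom p q) x : i q (sub_fmor f x) = fmor X f (i p x).
Proof. by rewrite /sub_fmor; case: cid => u /= ->. Qed.

Program Definition sub_functor : kfun := @KFunctor k A C K sub_fmor _ _ _.
Next Obligation. by move=> p x; apply: (@i_inj p); rewrite sub_fmorE fmor_id. Qed.
Next Obligation.
by move=> p q r g f x; apply: (@i_inj r); rewrite !sub_fmorE fmor_comp.
Qed.
Next Obligation.
by move=> p q c f g x; apply: (@i_inj q); rewrite linearP !sub_fmorE fmor_lin.
Qed.

Definition sub_incl : nat_trans sub_functor X :=
  @NatTrans _ _ _ sub_functor X i (fun p q f x => sub_fmorE f x).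
End SubFunctor.

(** Dually, structure maps of a quotient functor are those of [X] on
    representatives. *)
Section QuotientFunctor.
Variables (X : kfun) (Q : C -> lmodType A) (pr : forall p, linmap (X p) (Q p)).
Hypothesis pr_surj : forall p, surjective_map (pr p).
Hypothesis pr_stable : forall p q (f : chom p q) x, pr p x = 0 -> pr q (fmor X f x) = 0.

Definition quot_fmor p q (f : chom p q) : linmap (Q p) (Q q) :=
  projT1 (cid (linmap_descend (g := linmap_comp (pr q) (fmor X f)) (@pr_surj p)
    (pr_stable f))).

Lemma quot_fmorE p q (f : chom p q) x : quot_fmor f (pr p x) = pr q (fmor X f x).
Proof. by rewrite /quot_fmor; case: cid => u /= ->. Qed.

Program Definition quot_functor : kfun := @KFunctor k A C Q quot_fmor _ _ _.
Next Obligation.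
by move=> p y; have [x <-] := pr_surj y; rewrite quot_fmorE fmor_id.
Qed.
Next Obligation.
by move=> p q r g f y; have [x <-] := pr_surj y; rewrite !quot_fmorE fmor_comp.
Qed.
Next Obligation.
move=> p q c f g y; have [x <-] := pr_surj y.
by rewrite !quot_fmorE fmor_lin linearP.
Qed.

Definition quot_proj : nat_trans X quot_functor :=
  @NatTrans _ _ _ X quot_functor pr (fun p q f x => esym (quot_fmorE f x)).
End QuotientFunctor.

Section KernelCokernelFunctor.
Variables (X Y : kfun) (s : nat_trans X Y).

Fact ker_stable p q (f : chom p q) (x : ker_mod (s p)) :
  exists y : ker_mod (s q), ker_incl (s q) y = fmor X f (ker_incl (s p) x).
Proof. by apply/(ker_left_exact (s q)).2; rewrite ntfP ker_inclP linear0. Qed.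

Definition ker_functor : kfun :=
  sub_functor (fun p => (ker_left_exact (s p)).1) ker_stable.
Definition ker_functor_incl : nat_trans ker_functor X :=
  sub_incl (fun p => (ker_left_exact (s p)).1) ker_stable.

Lemma ker_functor_left_exact p : left_exact (ker_functor_incl p) (s p).
Proof. exact: ker_left_exact. Qed.

Fact coker_stable p q (f : chom p q) y :
  coker_proj (s p) y = 0 -> coker_proj (s q) (fmor Y f y) = 0.
Proof.
by move=> /coker_proj_eq0[x <-]; apply/coker_proj_eq0; exists (fmor X f x); rewrite ntfP.
Qed.

Definition coker_functor : kfun :=
  quot_functor (fun p => @coker_proj_surj _ _ _ (s p)) coker_stable.
Definition coker_functor_proj : nat_trans Y coker_functor :=
  quot_proj (fun p => @coker_proj_surj _ _ _ (s p)) coker_stable.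

Lemma coker_functor_right_exact p : right_exact (s p) (coker_functor_proj p).
Proof. exact: coker_right_exact. Qed.
End KernelCokernelFunctor.

Lemma nat_trans_factor (K X Z : kfun) (i : nat_trans K X) (g : nat_trans Z X) :
  (forall p, injective (i p)) -> (forall p z, exists x, i p x = g p z) ->
  exists u : nat_trans Z K, forall p z, i p (u p z) = g p z.
Proof.
move=> i_inj gi.
have [u iu] := dependent_choice (fun p => linmap_factor (@i_inj p) (gi p)).
have u_nat p q (f : chom p q) z : u q (fmor Z f z) = fmor K f (u p z).
  by apply: (i_inj q); rewrite iu !ntfP iu.
by exists (NatTrans u_nat).
Qed.

Lemma nat_trans_descend (Y Z T : kfun) (pr : nat_trans Y Z) (g : nat_trans Y T) :
  (forall p, surjective_map (pr p)) -> (forall p y, pr p y = 0 -> g p y = 0) ->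
  exists u : nat_trans Z T, forall p y, u p (pr p y) = g p y.
Proof.
move=> pr_surj gp.
have [u up] := dependent_choice (fun p => linmap_descend (@pr_surj p) (gp p)).
have u_nat p q (f : chom p q) z : u q (fmor Z f z) = fmor T f (u p z).
  by have [y <-] := pr_surj p z; rewrite -ntfP !up ntfP.
by exists (NatTrans u_nat).
Qed.

Lemma nat_trans_congr (X Y : kfun) (s t : nat_trans X Y) :
  s = t -> forall p x, s p x = t p x.
Proof. by move=> ->. Qed.

Lemma pointwise_kernel (K X Y : FunMod) (i : mor K X) (f : mor X Y) :
  (forall p, left_exact ((i : nat_trans K X) p) ((f : nat_trans X Y) p)) ->
  is_kernel i f.
Proof.
move=> ex; split; first by apply: nat_trans_ext => p x; apply/(ex p).2; exists x.
move=> Z g fg.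
have [p||u iu] := @nat_trans_factor K X Z i g; first exact: (ex p).1.
  by move=> p z; apply/(ex p).2; apply: (nat_trans_congr fg).
exists u; split; first exact: nat_trans_ext.
by move=> v iv; apply: nat_trans_ext => p z; apply: (ex p).1; rewrite iu -iv.
Qed.

Lemma pointwise_cokernel (X Y Z : FunMod) (f : mor X Y) (pr : mor Y Z) :
  (forall p, right_exact ((f : nat_trans X Y) p) ((pr : nat_trans Y Z) p)) ->
  is_cokernel f pr.
Proof.
move=> ex; split; first by apply: nat_trans_ext => p x; apply/(ex p).2; exists x.
move=> T g gf.
have [p||u up] := @nat_trans_descend Y Z T pr g; first exact: (ex p).1.
  by move=> p y /(ex p).2[x <-]; apply: (nat_trans_congr gf).
exists u; split; first exact: nat_trans_ext.
move=> v vp; apply: nat_trans_ext => p z; have [y <-] := (ex p).1 z.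
by rewrite up -vp.
Qed.

Lemma kernel_pointwise (K X Y : FunMod) (i : mor K X) (f : mor X Y) :
  is_kernel i f ->
  forall p, left_exact ((i : nat_trans K X) p) ((f : nat_trans X Y) p).
Proof.
move=> ker p; have ker0 := pointwise_kernel (ker_functor_left_exact f).
have [u [v [iu iv vu _]]] := kernel_unique ker ker0.
apply: (left_exact_iso (u := (u : nat_trans _ _) p) (v := (v : nat_trans _ _) p))
  (ker_functor_left_exact f p) => x.
- exact: (nat_trans_congr iu).
- exact: (nat_trans_congr iv).
- exact: (nat_trans_congr vu).
Qed.

Lemma cokernel_pointwise (X Y Z : FunMod) (f : mor X Y) (pr : mor Y Z) :
  is_cokernel f pr ->
  forall p, right_exact ((f : nat_trans X Y) p) ((pr : nat_trans Y Z) p).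
Proof.
move=> coker p; have coker0 := pointwise_cokernel (coker_functor_right_exact f).
have [u [v [up vp vu _]]] := cokernel_unique coker coker0.
apply: (right_exact_iso (u := (u : nat_trans _ _) p) (v := (v : nat_trans _ _) p))
  (coker_functor_right_exact f p) => x.
- exact: (nat_trans_congr up).
- exact: (nat_trans_congr vp).
- exact: (nat_trans_congr vu).
Qed.

Lemma pointwise_epi (X Y : FunMod) (f : mor X Y) :
  (forall p, surjective_map ((f : nat_trans X Y) p)) -> epi f.
Proof.
move=> f_surj Z g h e; apply: nat_trans_ext => p y; have [x <-] := f_surj p y.
exact: (nat_trans_congr e).
Qed.

Lemma epi_pointwise (X Y : FunMod) (f : mor X Y) :
  epi f -> forall p, surjective_map ((f : nat_trans X Y) p).
Proof.
move=> f_epi p y; apply/(coker_functor_right_exact f p).2.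
suff -> : coker_functor_proj f = 0 by [].
apply: (f_epi (coker_functor f)); apply: nat_trans_ext => q x.
by apply/(coker_functor_right_exact f q).2; exists x.
Qed.

Lemma FunMod_retract_summand (Y S : FunMod) : retract Y S -> direct_summand Y S.
Proof.
apply: retract_summand => U V f; exists (ker_functor f), (ker_functor_incl f).
exact/pointwise_kernel/ker_functor_left_exact.
Qed.

Lemma isomorphic_eval (X Y : FunMod) (p : C) :
  isomorphic X Y -> isomorphic (X p : Mod A) (Y p : Mod A).
Proof.
move=> [f [g [gf fg]]]; exists ((f : nat_trans X Y) p), ((g : nat_trans Y X) p).
by split; apply: linear_ext => x; [apply: (nat_trans_congr gf) | apply: (nat_trans_congr fg)].
Qed.

Lemma retract_eval (X Y : FunMod) (p : C) :
  retract X Y -> retract (X p : Mod A) (Y p : Mod A).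
Proof.
move=> [f [g gf]]; exists ((f : nat_trans X Y) p), ((g : nat_trans Y X) p).
by apply: linear_ext => x; apply: (nat_trans_congr gf).
Qed.

(** A finite coproduct is a biproduct, that is, a system of equations between
    morphisms, and any additive functor preserves those. *)
Lemma coproduct_eval n (F : 'I_n -> FunMod) (S : FunMod) (inj : forall i, mor (F i) S)
    (p : C) :
  is_coproduct inj ->
  @is_coproduct (Mod A) 'I_n (fun i => F i p) (S p)
    (fun i => (inj i : nat_trans (F i) S) p).
Proof.
move=> /coproduct_biproduct[proj [pi1 pi0 sum1]].
apply: (@biproduct_coproduct (Mod A) n (fun i => F i p) (S p) _
  (fun i => (proj i : nat_trans S (F i)) p)).
split=> [i|i j ij|].
- by apply: linear_ext => x; apply: (nat_trans_congr (pi1 i)).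
- by apply: linear_ext => x; apply: (nat_trans_congr (pi0 i j ij)).
rewrite -[RHS]/((idm S : nat_trans S S) p) -sum1.
by rewrite [RHS](big_morph (fun s : nat_trans S S => s p) (fun _ _ => erefl) erefl).
Qed.

Lemma exact_at_eval (X Y Z : FunMod) (f : mor X Y) (g : mor Y Z) (p : C) :
  exact_at f g ->
  @exact_at (Mod A) (X p) (Y p) (Z p) ((f : nat_trans X Y) p) ((g : nat_trans Y Z) p).
Proof.
move=> [K [i [e [ker e_epi ie]]]].
exists (K p), ((i : nat_trans K Y) p), ((e : nat_trans X K) p); split.
- exact/left_exact_kernel/kernel_pointwise.
- exact/surjective_epi/epi_pointwise.
- by apply: linear_ext => x; apply: (nat_trans_congr ie).
Qed.

Lemma short_exact_eval (X Y Z : FunMod) (f : mor X Y) (g : mor Y Z) (p : C) :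
  short_exact f g ->
  @short_exact (Mod A) (X p) (Y p) (Z p) ((f : nat_trans X Y) p) ((g : nat_trans Y Z) p).
Proof.
move=> [ker coker]; split; first exact/left_exact_kernel/kernel_pointwise.
exact/right_exact_cokernel/cokernel_pointwise.
Qed.

End FunctorCategory.

(** * Modules of k-linear maps out of a projective module *)

(** An alias of [M] that records [u], from which the action of [R] is inferred. *)
Definition restriction (R S : pzRingType) (u : {rmorphism R -> S}) (M : lmodType S) :
  Type := M.

Section RestrictionOfScalars.
Variables (R S : pzRingType) (u : {rmorphism R -> S}) (M : lmodType S).
Local Notation restr := (restriction u M).

HB.instance Definition _ := GRing.Zmodule.on restr.

Definition restr_scale (c : R) (x : restr) : restr := u c *: (x : M).
Fact restr_scaleA a b x : restr_scale a (restr_scale b x) = restr_scale (a * b) x.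
Proof. by rewrite /restr_scale scalerA rmorphM. Qed.
Fact restr_scale1 : left_id 1 restr_scale.
Proof. by move=> x; rewrite /restr_scale rmorph1 scale1r. Qed.
Fact restr_scaleDr : right_distributive restr_scale +%R.
Proof. by move=> a x y; apply: scalerDr. Qed.
Fact restr_scaleDl x : {morph restr_scale^~ x : a b / a + b}.
Proof. by move=> a b; rewrite /restr_scale rmorphD scalerDl. Qed.

HB.instance Definition _ := GRing.Zmodule_isLmodule.Build R restr
  restr_scaleA restr_scale1 restr_scaleDr restr_scaleDl.
End RestrictionOfScalars.

Section KHom.
Variables (k : comPzRingType) (A : kalgebra k).

Section Construction.
Variables (V : lmodType k) (M : lmodType A) (f : V -> M).
Hypothesis f_lin : linear_for (unit_map A \; *:%R) f.
Definition mk_khom : khom V M := HB.pack f (GRing.isLinear.Build _ _ _ _ _ f_lin).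
End Construction.

Section Postcomposition.
Variables (V : lmodType k) (M N : lmodType A) (g : linmap M N).

Fact khom_postcomp_subproof (h : khom V M) :
  linear_for (unit_map A \; *:%R) (fun v => g (h v)).
Proof. by move=> c v w; rewrite linearP /= linearP. Qed.
Definition khom_postcomp (h : khom V M) : khom V N := mk_khom (khom_postcomp_subproof h).
Fact khom_postcomp_linear : linear khom_postcomp.
Proof. by move=> a h h'; apply: linear_ext => v; apply: linearP. Qed.
Definition khom_post : linmap (khom V M) (khom V N) := mk_linmap khom_postcomp_linear.
End Postcomposition.

(** A linear map over [A] is in particular a morphism of [k]-modules, against
    which a projective [k]-module lifts. *)
Lemma khom_post_surjective (V : lmodType k) (M N : lmodType A) (g : linmap M N) :
  projective (V : Mod k) -> surjective_map g ->
  surjective_map (@khom_post V M N g).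
Proof.
move=> V_proj g_surj h.
pose toR (L : lmodType A) : lmodType k := restriction (unit_map A) L.
have g_lin : linear (g : toR M -> toR N) by move=> c x y; apply: (linearP g).
have h_lin : linear (h : V -> toR N) by move=> c x y; apply: (linearP h).
have [|h' gh'] := V_proj (toR M) (toR N) (mk_linmap g_lin) (mk_linmap h_lin).
  exact: surjective_epi.
have h'_lin : linear_for (unit_map A \; *:%R) ((h' : linmap V (toR M)) : V -> M).
  by move=> c x y; apply: (linearP (h' : linmap V (toR M))).
exists (mk_khom h'_lin); apply: linear_ext => v.
exact: (congr1 (fun f : linmap V (toR N) => f v) gh').
Qed.

(** Unlike surjectivity, this holds for every [V]: maps into the kernel of [f] are the
    maps killed by [f]. *)
Lemma khom_post_left_exact (V : lmodType k) (M N L : lmodType A)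
    (i : linmap M N) (f : linmap N L) :
  left_exact i f -> left_exact (@khom_post V _ _ i) (@khom_post V _ _ f).
Proof.
move=> [i_inj ex]; split.
  move=> h h' e; apply: linear_ext => v; apply: i_inj.
  exact: (congr1 (fun f : khom V N => f v) e).
move=> h; split=> [fh|[h' <-]]; last first.
  by apply: linear_ext => v; apply/ex; exists (h' v).
have /choice[u iu] v : exists x, i x = h v.
  by apply/ex; apply: (congr1 (fun f : khom V L => f v) fh).
have u_lin : linear_for (unit_map A \; *:%R) u.
  by move=> c v w; apply: i_inj; rewrite [RHS](linearP i) !iu linearP.
by exists (mk_khom u_lin); apply: linear_ext => v; apply: iu.
Qed.

(** The coordinates of a vector are given by a section of the projection of a finite
    free module onto [V]. *)
Lemma dual_basis (V : lmodType k) :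
  finitely_generated V -> projective (V : Mod k) ->
  exists n (e : 'I_n -> V) (x : 'I_n -> linmap V k^o),
    forall v, v = \sum_i x i v *: e i.
Proof.
move=> [n [e gen]] V_proj; exists n, e.
have sum_lin : linear (fun c : dprod (fun _ : 'I_n => k^o : lmodType k) => \sum_i c i *: e i).
  move=> a c d; rewrite scaler_sumr -big_split; apply: eq_bigr => i _.
  by rewrite /= scalerA -scalerDl.
have [|s es] := V_proj _ _ (mk_linmap sum_lin) (linmap_id V).
  by apply: surjective_epi => v; have [c ->] := gen v; exists c.
exists (fun i => linmap_comp (dproj _ i) s) => v.
exact: (congr1 (fun f : linmap V V => f v) (esym es)).
Qed.

(** A map out of [V] is determined by its values on a dual basis, and any
    values are those of the map that they span. *)
Lemma khom_retract_power (V : lmodType k) :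
  finitely_generated V -> projective (V : Mod k) ->
  exists n, forall M : lmodType A,
    retract (khom V M : Mod A) (dprod (fun _ : 'I_n => M) : lmodType A).
Proof.
move=> fg V_proj; have [n [e [x xe]]] := dual_basis fg V_proj; exists n => M.
have val_lin : linear (fun h : khom V M => (fun i => h (e i)) : dprod (fun _ : 'I_n => M)).
  by [].
have comb_lin (y : dprod (fun _ : 'I_n => M)) :
    linear_for (unit_map A \; *:%R) (fun v => \sum_i unit_map A (x i v) *: y i).
  move=> c v w /=; rewrite scaler_sumr -big_split; apply: eq_bigr => i _.
  by rewrite linearP rmorphD rmorphM /= scalerDl scalerA.
have span_lin : linear (fun y => mk_khom (comb_lin y)).
  move=> a y z; apply: linear_ext => v /=.
  rewrite scaler_sumr -big_split; apply: eq_bigr => i _.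
  by rewrite /= scalerDr !scalerA unit_central.
exists (mk_linmap val_lin), (mk_linmap span_lin); apply: linear_ext => h.
apply: linear_ext => v; rewrite {2}(xe v) linear_sum.
by apply: eq_bigr => i _; rewrite linearZ_LR.
Qed.

End KHom.

(** * Products of functors, and locally finite coproducts *)

Lemma finite_set_enum (T : Type) (S : set T) : finite_set S ->
  exists n (e : 'I_n -> T), injective e /\ forall x, S x -> exists j, e j = x.
Proof.
move=> /(@finite_seqP {classic T})[s Ss]; pose s' := undup s.
exists (size s'), (tnth (in_tuple s')); split.
  exact/(@tuple_uniqP _ {classic T})/undup_uniq.
move=> x; rewrite Ss /= -mem_undup => /(tnthP (in_tuple s'))[j xj].
by exists j.
Qed.

Section ProductFunctor.
Variables (k : comPzRingType) (A : kalgebra k) (C : small_klincat k).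
Local Notation kfun := (kfunctor A C).
Local Notation FunMod := (FunMod A C).
Variables (I : Type) (F : I -> kfun).

Definition product_fmor p q (f : chom p q) :
    linmap (dprod (fun i => F i p)) (dprod (fun i => F i q)) :=
  dpairing (fun i => linmap_comp (fmor (F i) f) (dproj _ i)).

Program Definition product_functor : kfun :=
  @KFunctor k A C (fun p => dprod (fun i => F i p)) product_fmor _ _ _.
Next Obligation. by move=> p x; apply: dprod_ext => i; apply: fmor_id. Qed.
Next Obligation. by move=> p q r g f x; apply: dprod_ext => i; apply: fmor_comp. Qed.
Next Obligation. by move=> p q c f g x; apply: dprod_ext => i; apply: fmor_lin. Qed.

Program Definition product_pair (X : kfun) (s : forall i, nat_trans X (F i)) :
    nat_trans X product_functor :=
  @NatTrans _ _ _ X product_functor (fun p => dpairing (fun i => s i p)) _.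
Next Obligation. by move=> X s p q f x; apply: dprod_ext => i; apply: ntfP. Qed.

Program Definition product_proj i : nat_trans product_functor (F i) :=
  @NatTrans _ _ _ product_functor (F i) (fun p => dproj _ i) _.
Next Obligation. by []. Qed.

Program Definition product_inj i : nat_trans (F i) product_functor :=
  @NatTrans _ _ _ (F i) product_functor (fun p => dinj (fun i => F i p) i) _.
Next Obligation.
move=> i p q f y; apply: dprod_ext => j.
rewrite -[RHS]/(fmor (F j) f (dinj (fun i => F i p) i y j)).
have [ij|ij] := pselect (i = j); first by case: j / ij; rewrite !dinj_same.
by rewrite !dinj_diff // linear0.
Qed.

(** Pointwise all but finitely many factors vanish, so the product is a finite
    biproduct, over an enumeration that varies with the object.  The mediating map
    is natural because it does not depend on the chosen enumerations. *)
Lemma product_coproduct :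
  (forall p, finite_set [set i | exists x : F i p, x <> 0]) ->
  @is_coproduct FunMod I F product_functor product_inj.
Proof.
move=> fin Z f.
have /dependent_choice[n /dependent_choice[e enum]] p :
    exists n, exists e : 'I_n -> I, injective e /\
      forall x : product_functor p, x = \sum_j product_inj (e j) p (x (e j)).
  have [n [e [e_inj ex]]] := finite_set_enum (fin p); exists n, e; split => // x.
  apply: dprod_decomp => // i ne; apply: contrapT => xi.
  by have [j /ne] : exists j, e j = i by apply: ex; exists (x i).
have e_inj p : injective (e p) by have [] := enum p.
have decomp p (x : product_functor p) :
    x = \sum_j product_inj (e p j) p (x (e p j)) by apply: (enum p).2.
pose u p : linmap (product_functor p) (Z p) :=
  \sum_j linmap_comp ((f (e p j) : nat_trans _ _) p) (dproj _ (e p j)).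
have uE p x : u p x = \sum_j (f (e p j) : nat_trans _ _) p (x (e p j)).
  by rewrite linmap_sumE.
(* the sum does not depend on the enumeration: it is [f i] on the i-th factor *)
have u_inj p i y : u p (product_inj i p y) = (f i : nat_trans _ _) p y.
  rewrite uE; have [[j ji]|ne] := pselect (exists j, e p j = i).
    case: i / ji y => y; rewrite (bigD1 j) // dinj_same big1 => [|l].
      exact: addr0.
    by move=> /eqP lj; rewrite dinj_diff ?linear0 // => /e_inj /esym.
  have ei j : e p j <> i by move=> ej; apply: ne; exists j.
  have y0 : y = 0.
    rewrite -[y](dinj_same (F := fun i => F i p)) -/(product_inj i p y).
    rewrite (decomp p (product_inj i p y)) dprod_sumE big1 // => j _.
    by rewrite dinj_diff.
  by rewrite big1 => [|j _]; rewrite ?y0 ?linear0 // dinj_diff ?linear0 // => /esym/ei.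
have u_nat p q (g : chom p q) x : u q (fmor product_functor g x) = fmor Z g (u p x).
  rewrite (decomp p x) !linear_sum; apply: eq_bigr => j _.
  by rewrite -ntfP !u_inj ntfP.
exists (NatTrans u_nat); split.
  by move=> i; apply: nat_trans_ext => p y; apply: u_inj.
move=> v vf; apply: nat_trans_ext => p x /=; rewrite (decomp p x) !linear_sum.
by apply: eq_bigr => j _; rewrite u_inj -vf.
Qed.

End ProductFunctor.

(** * The functors G_q *)

Section GFunctors.
Variables (k : comPzRingType) (A : kalgebra k) (C : small_klincat k).
Local Notation kfun := (kfunctor A C).
Local Notation FunMod := (FunMod A C).

(** [G_q] is right adjoint to evaluation at [q]: a map [phi : X q -> N] corresponds
    to [x |-> (g |-> phi (X g x))], and conversely a transformation is recovered
    from its values at the identity of [q], as in the Yoneda lemma. *)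
Section Adjunction.
Variables (q : C) (X : kfun) (N : lmodType A).

Section Transpose.
Variable phi : linmap (X q) N.

Fact G_transpose_value_subproof p (x : X p) :
  linear_for (unit_map A \; *:%R) (fun g : chom p q => phi (fmor X g x)).
Proof. by move=> c g h; rewrite fmor_lin linearP. Qed.
Definition G_transpose_value p (x : X p) : khom (chom p q) N :=
  mk_khom (@G_transpose_value_subproof p x).
Fact G_transpose_subproof p : linear (@G_transpose_value p).
Proof. by move=> a x y; apply: linear_ext => g; rewrite /= !linearP. Qed.

Program Definition G_transpose : nat_trans X (Gfun q N) :=
  @NatTrans _ _ _ X (Gfun q N) (fun p => mk_linmap (@G_transpose_subproof p)) _.
Next Obligation. by move=> p p' f x; apply: linear_ext => g; rewrite /= fmor_comp. Qed.
End Transpose.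

Section Untranspose.
Variable s : nat_trans X (Gfun q N).

Fact G_untranspose_subproof : linear (fun x : X q => s q x (Defs.cid q)).
Proof. by move=> a x y; rewrite linearP. Qed.
Definition G_untranspose : linmap (X q) N := mk_linmap G_untranspose_subproof.

Lemma G_untransposeK : G_transpose G_untranspose = s.
Proof.
apply: nat_trans_ext => p x; apply: linear_ext => g.
by rewrite /= ntfP /= ccomp1m.
Qed.
End Untranspose.

Lemma G_transposeE (phi : linmap (X q) N) x : G_transpose phi q x (Defs.cid q) = phi x.
Proof. by rewrite /= fmor_id. Qed.
End Adjunction.

Program Definition G_map (q : C) (M N : lmodType A) (phi : linmap M N) :
    nat_trans (Gfun q M) (Gfun q N) :=
  @NatTrans _ _ _ (Gfun q M) (Gfun q N) (fun p => khom_post (chom p q) phi) _.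
Next Obligation. by move=> q M N phi p p' f h; apply: linear_ext. Qed.

(** Evaluation at [q] is left adjoint to [G_q], which preserves epimorphisms since
    the [C(p,q)] are projective. *)
Lemma eval_projective (P : FunMod) (q : C) :
  (forall p : C, projective (chom p q : Mod k)) ->
  projective P -> projective (P q : Mod A).
Proof.
move=> hom_proj P_proj Y Z g f g_epi.
have [|h gh] := P_proj (Gfun q Y) (Gfun q Z) (G_map q g) (G_transpose f).
  by apply: pointwise_epi => p; apply: khom_post_surjective => //; apply: epi_surjective.
exists (G_untranspose h); apply: linear_ext => x.
rewrite -[RHS](G_transposeE (f : linmap _ _)).
exact: (congr1 (fun t : khom (chom q q) (Z : lmodType A) => t (Defs.cid q))
  (nat_trans_congr gh x)).
Qed.

Lemma projective_resolution_eval (X : FunMod) P d aug (q : C) :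
  (forall p : C, projective (chom p q : Mod k)) ->
  @projective_resolution FunMod X P d aug ->
  @projective_resolution (Mod A) (X q) (fun n => P n q)
    (fun n => (d n : nat_trans (P n.+1) (P n)) q) ((aug : nat_trans (P 0%N) X) q).
Proof.
move=> hom_proj [P_proj aug_epi ex0 ex]; split.
- by move=> n; apply: eval_projective.
- exact/surjective_epi/epi_pointwise.
- exact: exact_at_eval.
- by move=> n; apply: exact_at_eval.
Qed.

Definition G_product (N : C -> lmodType A) : kfun := product_functor (fun q => Gfun q (N q)).

Definition G_product_map (M N : C -> lmodType A) (phi : forall q, linmap (M q) (N q)) :
    nat_trans (G_product M) (G_product N) :=
  product_pair (fun q => nt_comp (G_map q (phi q)) (product_proj _ q)).

(** A nonzero value of [G_q (N q)] at [p] requires a nonzero map [p -> q]. *)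
Lemma G_product_coproduct (N : C -> lmodType A) : locally_bounded C ->
  @is_coproduct FunMod C (fun q => Gfun q (N q)) (G_product N)
    (product_inj (fun q => Gfun q (N q))).
Proof.
move=> bdd; apply: product_coproduct => p; apply: sub_finite_set (bdd p).
move=> q /= [h h0]; right; apply: contra_notP h0 => no_f.
apply: linear_ext => f; have [->|f0] := pselect (f = 0); first by rewrite linear0.
by case: no_f; exists f.
Qed.

End GFunctors.

(** * Exactness of products, and cokernels of maps out of a retract *)

Section ProductExactness.
Variables (R : pzRingType) (I : Type).

Definition dprod_map (M N : I -> lmodType R) (f : forall i, linmap (M i) (N i)) :
    linmap (dprod M) (dprod N) := dpairing (fun i => linmap_comp (f i) (dproj M i)).

Lemma dprod_choice (M N : I -> lmodType R) (f : forall i, linmap (M i) (N i))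
    (y : dprod N) :
  (forall i, exists x, f i x = y i) -> exists x, dprod_map f x = y.
Proof.
by move=> /dependent_choice[x fx]; exists x; apply: dprod_ext.
Qed.

Lemma dprod_exact_mid (M N L : I -> lmodType R) (f : forall i, linmap (M i) (N i))
    (g : forall i, linmap (N i) (L i)) :
  (forall i y, g i y = 0 <-> exists x, f i x = y) ->
  forall y, dprod_map g y = 0 <-> exists x, dprod_map f x = y.
Proof.
move=> ex y; split=> [gy|[x <-]]; last first.
  by apply: dprod_ext => i; apply/ex; exists (x i).
apply: dprod_choice => i; apply/ex.
exact: (congr1 (fun z : dprod L => z i) gy).
Qed.

Lemma dprod_left_exact (M N L : I -> lmodType R) (f : forall i, linmap (M i) (N i))
    (g : forall i, linmap (N i) (L i)) :
  (forall i, left_exact (f i) (g i)) -> left_exact (dprod_map f) (dprod_map g).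
Proof.
move=> ex; split; last by apply: dprod_exact_mid => i; apply: (ex i).2.
move=> x y e; apply: dprod_ext => i; apply: (ex i).1.
exact: (congr1 (fun z : dprod N => z i) e).
Qed.

Lemma dprod_right_exact (M N L : I -> lmodType R) (f : forall i, linmap (M i) (N i))
    (g : forall i, linmap (N i) (L i)) :
  (forall i, right_exact (f i) (g i)) -> right_exact (dprod_map f) (dprod_map g).
Proof.
move=> ex; split; last by apply: dprod_exact_mid => i; apply: (ex i).2.
by move=> y; apply: dprod_choice => i; apply: (ex i).1.
Qed.

End ProductExactness.

Section ModuleClasses.
Variables (R : pzRingType) (XX : Mod R -> Prop).
Hypotheses (XX_sub : subcategory XX) (XX_ext : closed_under_extensions XX).
Hypothesis XX_summands : closed_under_summands XX.

Lemma retract_closed (Y S : Mod R) : retract Y S -> XX S -> XX Y.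
Proof. by move=> /Mod_retract_summand; apply: XX_summands. Qed.

Lemma dprod_closed (I : Type) (F : I -> lmodType R) n (e : 'I_n -> I) :
  injective e -> (forall i, (forall j, e j <> i) -> forall y : F i, y = 0) ->
  (forall j, XX (F (e j))) -> XX (dprod F : lmodType R).
Proof.
move=> e_inj triv XF; apply: XX_sub.2 XF.
exact: (biproduct_coproduct (dprod_biproduct e_inj triv)).
Qed.

(** If [X] is a retract of [P] and [P] embeds in [W] with cokernel [T], then
    [W / X] is an extension of [T] by the complement of [X] in [P], which is the
    kernel of the retraction. *)
Lemma cokernel_of_retract_closed (X P W T Q : lmodType R)
    (i : linmap X P) (r : linmap P X) (w : linmap P W) (t : linmap W T)
    (c : linmap W Q) :
  (forall x, r (i x) = x) -> left_exact w t -> right_exact w t ->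
  right_exact (linmap_comp w i) c -> XX P -> XX T -> XX Q.
Proof.
move=> ri [w_inj wt] [t_surj _] [c_surj wic] XP XT.
have [b bc] : exists b : linmap Q T, forall y, b (c y) = t y.
  apply: linmap_descend => // y /wic[x <-].
  by apply/wt; exists (i x).
pose a := linmap_comp c (linmap_comp w (ker_incl r)).
have XK : XX (ker_mod r : lmodType R).
  apply: (retract_closed _ XP).
  (* the projection of [P] onto [ker r] is [1 - i r] *)
  have rp y : r (y - i (r y)) = 0 by rewrite linearB ri subrr.
  have p_lin : linear (fun y => ker_mk (rp y)).
    move=> d y z; apply: val_inj; rewrite [RHS]ker_incl_linear /= (linearP r) (linearP i).
    by rewrite scalerBr opprD addrACA.
  exists (ker_incl r), (mk_linmap p_lin); apply: linear_ext => x; apply: val_inj.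
  by rewrite /= [r _]ker_inclP linear0 subr0.
apply: (@XX_ext (ker_mod r : lmodType R) Q T a b _ XK XT).
apply: short_exact_elementwise.
  move=> x y e; apply/eqP; rewrite -subr_eq0; apply/eqP.
  have /wic[z] : c (w (ker_incl r (x - y))) = 0.
    by rewrite !linearB; apply/eqP; rewrite subr_eq0; apply/eqP.
  (* an element of [ker r] that comes from [X] is zero *)
  move=> /w_inj iz; apply: val_inj.
  have z0 : z = 0 by rewrite -(ri z) iz ker_inclP.
  by rewrite -[LHS]iz z0 linear0.
split=> [y|y]; first by have [z <-] := t_surj y; exists (c z); rewrite bc.
have [z <-] := c_surj y; rewrite bc; split.
  (* [c] does not see the component [i (r v)] of [v] in [X] *)
  move=> /wt[v <-]; have rv : r (v - i (r v)) = 0 by rewrite linearB ri subrr.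
  have cwi0 : c (w (i (r v))) = 0 by apply/wic; exists (r v).
  by exists (ker_mk rv); rewrite /= !linearB cwi0 subr0.
by move=> [x /(congr1 b)]; rewrite !bc => <-; apply/wt; exists (ker_incl r x).
Qed.

End ModuleClasses.

(** * The Frobenius pair of functors *)

Section FrobeniusPair.
Variables (k : comPzRingType) (A : kalgebra k) (C : small_klincat k).
Local Notation kfun := (kfunctor A C).
Local Notation FunMod := (FunMod A C).
Implicit Types XX WW : Mod A -> Prop.

(** The coproduct in the definition of [tilde] is only given up to isomorphism; this
    replaces it by the explicit [G_product N]. *)
Lemma tilde_retract WW (Y : FunMod) : locally_bounded C ->
  tilde WW Y <->
  exists N : C -> Mod A, (forall q, WW (N q)) /\ retract Y (G_product N : FunMod).
Proof.
move=> bdd; split=> [[N [S [inj [WN cop /summand_retract YS]]]]|[N [WN YN]]].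
  exists N; split=> //; apply: retract_trans YS _.
  by have [] := isomorphic_retract (coproduct_unique cop (G_product_coproduct (N := N) bdd)).
exists N, (G_product N), (product_inj (fun q => Gfun q (N q))).
by split=> //; [apply: G_product_coproduct | apply: FunMod_retract_summand].
Qed.

(** The product over all [q] reduces to the finitely many [q] with [C(p,q)] nonzero,
    and the dual basis of [C(p,q)] compares each factor to a power of [N q]. *)
Lemma G_product_closed XX (N : C -> Mod A) : hom_finite C -> locally_bounded C ->
  subcategory XX -> closed_under_summands XX ->
  (forall q, XX (N q)) -> forall p, XX (G_product N p).
Proof.
move=> fin bdd XX_sub XX_summands XN p.
have [n [e [e_inj ex]]] := finite_set_enum (bdd p).
apply: (dprod_closed XX_sub e_inj) => [q ne h|j].
  apply: linear_ext => f; have [->|f0] := pselect (f = 0); first by rewrite linear0.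
  by have [j /ne] : exists j, e j = q by apply: ex; right; exists f.
have [m] := khom_retract_power A (fin p (e j)).1 (fin p (e j)).2.
move=> /(_ (N (e j))) /(retract_closed XX_summands); apply.
by apply: (dprod_closed XX_sub (e := id)) => // i /(_ i)/(_ erefl).
Qed.

Lemma fun_in_subcategory XX : subcategory XX -> subcategory (fun_in (C := C) XX).
Proof.
move=> [XX_iso XX_cop]; split.
  by move=> X Y XY XXX q; apply: XX_iso (isomorphic_eval q XY) (XXX q).
move=> n F S inj cop XF q.
exact: (XX_cop _ _ _ _ (coproduct_eval cop) (fun i => XF i q)).
Qed.

Lemma tilde_summands WW : locally_bounded C ->
  closed_under_summands (tilde (C := C) WW).
Proof.
move=> bdd Y S /summand_retract YS /(tilde_retract _ _ bdd)[N [WN SN]].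
by apply/(tilde_retract _ _ bdd); exists N; split=> //; apply: retract_trans YS SN.
Qed.

(** A finite sum of the functors [G_product (N i)] is [G_product] of the pointwise
    sums of the families [N i], because [G_product] is additive. *)
Lemma tilde_subcategory WW : locally_bounded C ->
  subcategory WW -> subcategory (tilde (C := C) WW).
Proof.
move=> bdd WW_sub; split.
  move=> X Y /isomorphic_retract[_ YX] /(tilde_retract _ _ bdd)[N [WN XN]].
  by apply/(tilde_retract _ _ bdd); exists N; split=> //; apply: retract_trans YX XN.
move=> n F S inj /coproduct_biproduct[proj bip] WF.
have /choice[N WN] i : exists N : C -> Mod A,
    (forall q, WW (N q)) /\ retract (F i) (G_product N : FunMod).
  exact/(tilde_retract _ _ bdd)/WF.
apply/(tilde_retract _ _ bdd).
exists (fun q => dprod (fun i => N i q) : lmodType A); split.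
  move=> q; apply: (dprod_closed WW_sub (e := id)) => //; first by move=> i /(_ i)/(_ erefl).
  by move=> i; apply: (WN i).1.
have [a retr] := dependent_choice (fun i => (WN i).2).
have [b ba] := dependent_choice retr.
pose tau i : mor (G_product (N i) : FunMod) (G_product _) :=
  G_product_map (fun q => dinj (fun i => N i q) i).
pose pi i : mor (G_product _ : FunMod) (G_product (N i)) :=
  G_product_map (fun q => dproj (fun i => N i q) i).
have pi_tau i : pi i ∘ tau i = idm _.
  apply: nat_trans_ext => p x; apply: dprod_ext => q; apply: linear_ext => g.
  exact: dinj_same.
have pi_tau0 i j : i <> j -> pi j ∘ tau i = 0.
  move=> ij; apply: nat_trans_ext => p x; apply: dprod_ext => q; apply: linear_ext => g.
  exact: dinj_diff.
apply: (retract_of_biproduct (a := fun i => tau i ∘ a i) (b := fun i => b i ∘ pi i) bip).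
  by move=> i; rewrite compmA -(compmA (b i)) pi_tau compm1 ba.
by move=> i j ij; rewrite compmA -(compmA (b j)) pi_tau0 // compm0 comp0m.
Qed.

Lemma fun_in_extensions XX :
  closed_under_extensions XX -> closed_under_extensions (fun_in (C := C) XX).
Proof.
move=> XX_ext X Y Z f g fg XXX XXZ q.
exact: (XX_ext _ _ _ _ _ (short_exact_eval q fg) (XXX q) (XXZ q)).
Qed.

Lemma fun_in_kernels XX :
  closed_under_kernels_of_epis XX -> closed_under_kernels_of_epis (fun_in (C := C) XX).
Proof.
move=> XX_ker K X Y i f f_epi ker XXX XXY q.
apply: (@XX_ker (K q) (X q) (Y q) ((i : nat_trans K X) q) ((f : nat_trans X Y) q)) => //.
  by apply: surjective_epi; apply: epi_pointwise.
by apply: left_exact_kernel; apply: kernel_pointwise.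
Qed.

Lemma fun_in_summands XX :
  closed_under_summands XX -> closed_under_summands (fun_in (C := C) XX).
Proof.
move=> XX_summands Y S /summand_retract YS XXS q.
apply: (retract_closed XX_summands _ (XXS q)); exact: retract_eval.
Qed.

Lemma tilde_sub_fun_in XX WW : hom_finite C -> locally_bounded C ->
  subcategory XX -> closed_under_summands XX -> (forall M, WW M -> XX M) ->
  forall Y, tilde (C := C) WW Y -> fun_in XX Y.
Proof.
move=> fin bdd XX_sub XX_summands WX Y /(tilde_retract _ _ bdd)[N [WN YN]] p.
apply: (retract_closed XX_summands (retract_eval p YN)).
by apply: G_product_closed => // q; apply/WX/WN.
Qed.

(** The units of the adjunctions at all [q] together: [x] goes to the family of the maps
    [g |-> X g x]. *)
Definition G_unit (X : kfun) : nat_trans X (G_product X) :=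
  product_pair (fun q => G_transpose (linmap_id (X q))).

(** Evaluating the component at [p] at the identity of [p] recovers [x].  The splitting
    is not natural in [p]. *)
Lemma G_unit_retraction (X : kfun) (p : C) :
  exists r : linmap (G_product X p) (X p), forall x, r (G_unit X p x) = x.
Proof.
have r_lin : linear (fun y : G_product X p => y p (Defs.cid p)) by [].
by exists (mk_linmap r_lin) => x; apply: G_transposeE.
Qed.

Lemma fun_in_cogenerated XX WW : hom_finite C -> locally_bounded C ->
  subcategory XX -> closed_under_extensions XX -> closed_under_summands XX ->
  (forall X, XX X -> exists W X' (f : mor X W) (g : mor W X'),
     [/\ WW W, XX X' & short_exact f g]) ->
  forall X : FunMod, fun_in XX X -> exists W X' (f : mor X W) (g : mor W X'),
    [/\ tilde WW W, fun_in XX X' & short_exact f g].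
Proof.
move=> fin bdd XX_sub XX_ext XX_summands cogen X XXX.
have cogen_q (q : C) : exists W T (f : linmap (X q) W) (g : linmap W T),
    [/\ WW W, XX T, left_exact f g & right_exact f g].
  have [W [T [f [g [WW_W XX_T [ker coker]]]]]] := cogen _ (XXX q).
  exists W, T, f, g; split=> //; first exact: kernel_left_exact.
  exact: cokernel_right_exact.
have [W {}cogen_q] := dependent_choice cogen_q.
have [T {}cogen_q] := dependent_choice cogen_q.
have [f {}cogen_q] := dependent_choice cogen_q.
have [g {}cogen_q] := dependent_choice cogen_q.
pose s : nat_trans X (G_product W) := nt_comp (G_product_map f) (G_unit X).
have map_left (p : C) : left_exact (G_product_map f p) (G_product_map g p).
  apply: dprod_left_exact => q; apply: khom_post_left_exact.
  by have [] := cogen_q q.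
have map_right (p : C) : right_exact (G_product_map f p) (G_product_map g p).
  apply: dprod_right_exact => q; split.
    apply: khom_post_surjective; first exact: (fin p q).2.
    by have [_ _ _ []] := cogen_q q.
  by apply: (khom_post_left_exact _ _).2; have [] := cogen_q q.
exists (G_product W), (coker_functor s), s, (coker_functor_proj s); split.
- apply/(tilde_retract _ _ bdd); exists W; split; last exact: retract_refl.
  by move=> q; have [] := cogen_q q.
- move=> p; have [r rP] := G_unit_retraction X p.
  apply: (cokernel_of_retract_closed XX_ext XX_summands rP (map_left p) (map_right p)
    (coker_functor_right_exact s p)).
    exact: G_product_closed.
  by apply: G_product_closed => // q; have [] := cogen_q q.
- split; last exact/pointwise_cokernel/coker_functor_right_exact.
  apply: pointwise_kernel => p; split; last first.
    exact: (coker_functor_right_exact s p).2.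
  have [r rP] := G_unit_retraction X p.
  exact: inj_comp (map_left p).1 (can_inj rP).
Qed.

(** A cocycle [z] with values in [Y] becomes one with values in [G_product N], hence
    a family of cocycles [P (n+1) q -> N q].  The maps that bound them assemble,
    by adjunction, to [B], which the retraction onto [Y] brings back. *)
Lemma tilde_ext_zero XX WW : hom_finite C -> locally_bounded C ->
  (forall X W n, XX X -> WW W -> ext_zero n X W) ->
  forall (X Y : FunMod) n, fun_in XX X -> tilde WW Y -> ext_zero n X Y.
Proof.
move=> fin bdd ext0 X Y n XXX /(tilde_retract _ _ bdd)[N [WN [i [r ri]]]].
move=> P d aug res z zd.
have /dependent_choice[b bE] (q : C) : exists b : linmap (P n q) (N q),
    G_untranspose (nt_comp (product_proj _ q) (nt_comp i z)) =
    linmap_comp b ((d n : nat_trans _ _) q).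
  have resq := projective_resolution_eval (q := q) (fun p => (fin p q).2) res.
  apply: (ext0 _ _ n (XXX q) (WN q) _ _ _ resq); apply: linear_ext => x.
  rewrite /= -[(z : nat_trans _ _) q _]/((z ∘ d n.+1 : nat_trans _ _) q x) zd.
  by rewrite linear0.
pose B : nat_trans (P n) (G_product N) := product_pair (fun q => G_transpose (b q)).
exists (r ∘ (B : mor (P n) (G_product N : FunMod))).
rewrite -compmA -[LHS]comp1m -ri -compmA; congr (_ ∘ _).
apply: nat_trans_ext => p x; apply: dprod_ext => q.
pose t := nt_comp (product_proj (fun q => Gfun q (N q)) q) (nt_comp i z).
transitivity (t p x); first by [].
rewrite -(G_untransposeK t) bE; apply: linear_ext => g /=.
by rewrite ntfP.
Qed.

End FrobeniusPair.

Theorem theorem3p7 (k : comPzRingType) (A : kalgebra k) (C : small_klincat k)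
  (C_hom_finite : hom_finite C) (C_locally_bounded : locally_bounded C)
  (XX WW : Mod A -> Prop) :
  left_frobenius_pair XX WW ->
  left_frobenius_pair (fun_in (C := C) XX) (tilde (C := C) WW).
Proof.
move=> [[XX_sub WW_sub] XX_ext XX_ker XX_summands [[WX cogen ext0] WW_summands]].
split.
- by split; [apply: fun_in_subcategory | apply: tilde_subcategory].
- exact: fun_in_extensions.
- exact: fun_in_kernels.
- exact: fun_in_summands.
- split; last exact: tilde_summands.
  split; first exact: tilde_sub_fun_in.
    exact: fun_in_cogenerated.
  exact: tilde_ext_zero.
Qed.
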